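(* Let the coefficients $b,\sigma$ satisfy the Lipschitz assumption stated in the context, let $h>0$ be fixed, and for every $N\ge1$ let $(\vec\zeta^N,\vec W^N)=(\zeta^{i,N},W^{i,N})_{1\le i\le N}\in L^p_{\mathbb P}(\Omega,(\mathbb R^d\times\mathcal C^{d'})^N)$, with $\vec X^{h,N}$ the solution of the discretised particle system with this input. (i) Let $(\zeta,W)\in L^p_{\mathbb P}(\Omega,\mathbb R^d\times\mathcal C^{d'})$ and let $X^h$ be the pathwise solution of the discretised McKean-Vlasov equation with input $(\zeta,W)$. If $W_p(\pi(\vec\zeta^N,\vec W^N),\mathcal L(\zeta,W))\to0$ $\mathbb P$-a.s. as $N\to+\infty$, then $W_p(\pi(\vec X^{h,N}),\mathcal L(X^h))\to0$ $\mathbb P$-a.s. as $N\to+\infty$. (ii) If the sequence $(\mathcal L(\pi(\vec\zeta^N,\vec W^N)))_{N\geq 1}$ satisfies the large deviation principle with good rate function $I:\mathcal P_p(\mathbb R^d\times\mathcal C^{d'})\to[0,+\infty]$, then the sequence $(\mathcal L(\pi(\vec X^{h,N})))_{N\ge1}$ satisfies the large deviation principle with good rate function $$P\in\mathcal P_p(\mathcal C^d)\mapsto\inf_{\substack{R\in\mathcal P_p(\mathbb R^d\times\mathcal C^{d'})\\ \Psi_h(R)=P}}I(R).$$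
   Context: Fix $T>0$, integers $d,d'\ge1$ and $p\ge1$. For $k\ge 1$, $\mathcal C^k:=C([0,T],\mathbb R^k)$ with the sup norm. For a Polish space $E$, $\mathcal P_p(E)$ is the set of probability measures on $E$ with finite $p$-th moment, endowed with the Wasserstein distance $W_p$; $L^p_{\mathbb P}(\Omega,E)$ is the set of $E$-valued random variables whose law is in $\mathcal P_p(E)$; $\mathcal L(X)$ denotes the law of $X$. For $x\in\mathcal C^d$, $x_{\wedge t}:=(x_{s\wedge t})_{0\le s\le T}$, and $P_{\wedge t}$ is the push-forward of $P$ by $x\mapsto x_{\wedge t}$. Empirical measures: $\pi(\vec x^N):=\frac1N\sum_{i=1}^N\delta_{x^i}$, $\pi(\vec x^N,\vec y^N):=\frac1N\sum_{i=1}^N\delta_{(x^i,y^i)}$. Coefficients: continuous functions $b:[0,T]\times\mathcal C^d\times\mathcal P_p(\mathcal C^d)\to\mathbb R^d$ and $\sigma:[0,T]\times\mathcal C^d\times\mathcal P_p(\mathcal C^d)\to\mathbb R^{d\times d'}$. Lipschitz assumption: there are $L_b,L_\sigma>0$ and functions $\overline b,\overline\sigma$ (same domains and codomains), globally $L_b$- and $L_\sigma$-Lipschitz respectively, such that $b_t(x,P)=\overline b_t(x_{\wedge t},P_{\wedge t})$ and $\sigma_t(x,P)=\overline\sigma_t(x_{\wedge t},P_{\wedge t})$ for all $(t,x,P)$; moreover $\sigma$ is globally bounded by some $M_\sigma>0$. Discretised equations: $t_h:=h\lfloor t/h\rfloor$. For $P\in\mathcal P_p(\mathcal C^d)$, $(\zeta,w)\in\mathbb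 R^d\times\mathcal C^{d'}$, $x\in\mathcal C^d$, define $f^{h,P}(\zeta,w,x)\in\mathcal C^d$ by $$f^{h,P}_t(\zeta,w,x)=\zeta+(t-t_h)b_{t_h}(x,P)+\sigma_{t_h}(x,P)[w_t-w_{t_h}]+\sum_{i=0}^{\lfloor t/h\rfloor-1}\big(h\,b_{ih}(x,P)+\sigma_{ih}(x,P)[w_{(i+1)h}-w_{ih}]\big).$$ The pathwise solution of the discretised McKean-Vlasov equation with input $(\zeta,W)$ is the unique $X^h\in L^p_{\mathbb P}(\Omega,\mathcal C^d)$ with, a.s., $X^h_t=f_t^{h,\mathcal L(X^h)}(\zeta,W,X^h)$ for all $t\in[0,T]$. Its law depends only on $\mathcal L(\zeta,W)$, and $\Psi_h:\mathcal P_p(\mathbb R^d\times\mathcal C^{d'})\to\mathcal P_p(\mathcal C^d)$ denotes the map $\mathcal L(\zeta,W)\mapsto\mathcal L(X^h)$. The solution of the discretised particle system with input $(\vec\zeta^N,\vec W^N)$ is the a.s. unique $\vec X^{h,N}=(X^{h,i,N})_{1\le i\le N}$ with, a.s., $X^{h,i,N}_t=f_t^{h,\pi(\vec X^{h,N})}(\zeta^{i,N},W^{i,N},X^{h,i,N})$ for all $i,t$. No independence or exchangeability of the inputs is assumed. Large deviation principle (LDP): a sequence $(\mu_N)$ of probability measures on a Polish space $S$ satisfies the LDP (at speed $N$) with good rate function $I:S\to[0,+\infty]$ if $I$ has compact sublevel sets, $\limsup_N N^{-1}\log\mu_N(A)\le-\inf_AI$ for closed $A$, and $\liminf_NN^{-1}\log\mu_N(A)\ge-\inf_AI$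 for open $A$. Here the $\mathcal P_p$ spaces carry the $W_p$-topology. *)

(* Defs.v *)
From HB Require Import structures.
From mathcomp Require Import all_boot all_order all_algebra.
From mathcomp Require Import all_classical all_reals all_analysis.
From mathcomp Require Import measurable_realfun lra.
Set Implicit Arguments.
Unset Strict Implicit.
Unset Printing Implicit Defensive.
Import Order.TTheory GRing.Theory Num.Theory.
Import numFieldNormedType.Exports.
Local Open Scope classical_set_scope.
Local Open Scope ring_scope.

(* The space C([0,T], R^k) with the sup norm, where R^k carries the max norm of
   the library (all norms on R^k give the same statements). A path is represented by its unique extension to R
   that is constant on ]-oo, 0] and on [T, +oo[, so that two paths are equal
   as soon as they agree on [0,T]. *)
Definition clamp (R : realType) (T t : R) : R := Num.max 0 (Num.min t T).

Lemma clamp_min (R : realType) (T s t : R) : 0 < T ->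
  clamp T (Num.min s t) = clamp T (Num.min (clamp T s) t).
Proof.
rewrite /clamp => T0; rewrite !minElt !maxElt.
repeat match goal with |- context [if ?a then _ else _] =>
  lazymatch a with
  | context [if _ then _ else _] => fail
  | _ => case: (boolP a); rewrite -?leNgt; intro
  end end; lra.
Qed.

Definition is_cpath (R : realType) (T : {posnum R}) (k : nat) :
    {pred R -> 'cV[R]_k} :=
  fun x => `[< continuous x /\ forall t, x t = x (clamp T%:num t) >].

Record cpath (R : realType) (T : {posnum R}) (k : nat) := CPath {
  cpath_fun :> R -> 'cV[R]_k ;
  cpath_subproof : cpath_fun \in @is_cpath R T k }.

HB.instance Definition _ (R : realType) (T : {posnum R}) (k : nat) :=
  [isSub for @cpath_fun R T k].
HB.instance Definition _ (R : realType) (T : {posnum R}) (k : nat) :=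
  [Choice of @cpath R T k by <:].

Section cpath_theory.
Variables (R : realType) (T : {posnum R}) (k : nat).
Implicit Types x y : cpath T k.

Lemma cpath_continuous x : continuous x.
Proof. by case: x => f /= /asboolP[]. Qed.

Lemma cpath_clamp x t : x t = x (clamp T%:num t).
Proof. by case: x => f /= /asboolP[]. Qed.

Lemma clamp_itv (t : R) : clamp T%:num t \in `[0, T%:num].
Proof. by rewrite in_itv /= /clamp le_max lexx /= ge_max ge_min lexx orbT andbT. Qed.

Lemma is_cpath_submod : submod_closed (@is_cpath R T k).
Proof.
split; first by apply/asboolP; split => // t; exact: cvg_cst.
move=> a x y /asboolP[cx ex] /asboolP[cy ey]; apply/asboolP; split.
  move=> t; apply: (@cvgD _ _ _ _ _ (a *: x) y); last exact: cy.
  by apply: cvgZl_tmp; exact: cx.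
by move=> t /=; rewrite !fctE /= {1}ex {1}ey.
Qed.

HB.instance Definition _ :=
  GRing.isSubmodClosed.Build _ _ (@is_cpath R T k) is_cpath_submod.
HB.instance Definition _ := [SubChoice_isSubLmodule of cpath T k by <:].

Definition sup_norm x : R := sup [set `|x t| | t in `[0, T%:num]%classic].

Lemma cpathD x y t : (x + y) t = x t + y t. Proof. by []. Qed.
Lemma cpathZ a x t : (a *: x) t = a *: x t. Proof. by []. Qed.

Lemma sup_norm_has_sup x : has_sup [set `|x t| | t in `[0, T%:num]%classic].
Proof.
split; first by exists `|x 0|; exists 0 => //=; rewrite in_itv /= lexx ltW.
have : compact ((fun t => x t) @` `[0, T%:num]%classic).
  apply: continuous_compact (@segment_compact _ _ _).
  by apply: continuous_subspaceT => t; exact: cpath_continuous.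
move=> /compact_bounded [M [Mr MP]].
exists (M + 1) => _ [t tT <-]; apply: (MP (M + 1)); first by rewrite ltrDl.
by exists t.
Qed.

Lemma le_sup_norm x t : `|x t| <= sup_norm x.
Proof.
rewrite cpath_clamp; apply: sup_upper_bound; first exact: sup_norm_has_sup.
by exists (clamp T%:num t) => //=; exact: clamp_itv.
Qed.

Lemma sup_norm_le x (M : R) : (forall t, `|x t| <= M) -> sup_norm x <= M.
Proof.
move=> xM; apply: ge_sup; first by have [] := sup_norm_has_sup x.
by move=> _ [t _ <-].
Qed.

Lemma sup_normD x y : sup_norm (x + y) <= sup_norm x + sup_norm y.
Proof.
apply: sup_norm_le => t; rewrite cpathD.
by apply: le_trans (ler_normD _ _) _; apply: lerD; exact: le_sup_norm.
Qed.

Lemma sup_normZ (a : R) x : sup_norm (a *: x) = `|a| * sup_norm x.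
Proof.
have le (b : R) y : sup_norm (b *: y) <= `|b| * sup_norm y.
  by apply: sup_norm_le => t; rewrite cpathZ normrZ ler_wpM2l ?le_sup_norm.
apply/eqP; rewrite eq_le le /=.
have [->|a0] := eqVneq a 0.
  rewrite normr0 mul0r; apply: le_trans (le_sup_norm _ 0).
  exact: normr_ge0.
rewrite mulrC -ler_pdivlMr ?normr_gt0// mulrC -normfV.
by apply: le_trans (le _ _); rewrite scalerA mulVf// scale1r.
Qed.

Lemma sup_norm_eq0 x : sup_norm x = 0 -> x = 0.
Proof.
move=> x0; apply: val_inj; apply/funext => t /=; apply/eqP.
by rewrite -normr_le0 -x0 le_sup_norm.
Qed.

HB.instance Definition _ := @Lmodule_isNormed.Build R (cpath T k) sup_norm
  sup_normD sup_normZ sup_norm_eq0.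

Lemma cpath_normE x : `|x| = sup_norm x. Proof. by []. Qed.

Lemma stop_subproof (t : R) x :
  (fun s => x (Num.min s t)) \in @is_cpath R T k.
Proof.
apply/asboolP; split.
  move=> s; apply: (@continuous_comp _ _ _ (fun s : R => Num.min s t) x).
    by apply: continuous_min; [exact: cvg_id|exact: cvg_cst].
  exact: cpath_continuous.
move=> s; rewrite cpath_clamp [RHS]cpath_clamp; congr (x _).
exact: clamp_min.
Qed.

Definition stop (t : R) x : cpath T k := CPath (stop_subproof t x).

End cpath_theory.

Notation borel E := (g_sigma_algebraType (@open E)).

Section borel_theory.
Variable R : realType.

Lemma open_measurable_borel (E : normedModType R) (A : set E) :
  open A -> measurable (A : set (borel E)).
Proof. by move=> oA; exact: sub_sigma_algebra. Qed.

Lemma continuous_borel (E F : normedModType R) (f : E -> F) :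
  continuous f -> measurable_fun setT (f : borel E -> borel F).
Proof.
move=> /continuousP cf; apply: (@measurability _ _ (borel E) (borel F) setT f (@open F)) => //.
by move=> _ [A oA <-]; rewrite setTI; apply: open_measurable_borel; exact: cf.
Qed.

Lemma continuous_borel_real (E : normedModType R) (f : E -> R) :
  continuous f -> measurable_fun setT (f : borel E -> R).
Proof.
move=> /continuousP cf; apply: (measurability _ (RGenOpens.measurableE R)).
move=> _ [_ [a [b ->] <-]]; rewrite setTI.
by apply: open_measurable_borel; apply: cf; exact: interval_open.
Qed.

Lemma measurable_norm_powR (E : normedModType R) (p : R) :
  measurable_fun setT (fun x : borel E => (`|x : E| `^ p)%:E).
Proof.
apply/measurable_EFinP.
apply: (measurableT_comp (measurable_powR p)).
by apply: continuous_borel_real => x; exact: norm_continuous.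
Qed.

End borel_theory.

Definition moment (R : realType) (E : normedModType R) (p : R)
    (mu : set (borel E) -> \bar R) : \bar R :=
  (\int[mu]_x (`|x : E| `^ p)%:E)%E.

(* The space P_p(E). In the library a measure is a function defined on all
   subsets; requiring it to vanish on the non-measurable ones makes equality of
   elements of P_p(E) coincide with equality on the Borel sets. *)
Record wspace (R : realType) (p : R) (E : normedModType R) := WSpace {
  wmeas :> probability (borel E) R ;
  wspace_moment : (moment p wmeas < +oo)%E ;
  wspace_null : forall A : set (borel E), ~ measurable A -> wmeas A = 0%E }.

HB.instance Definition _ (R : realType) (p : R) (E : normedModType R) :=
  gen_eqMixin (wspace p E).
HB.instance Definition _ (R : realType) (p : R) (E : normedModType R) :=
  gen_choiceMixin (wspace p E).

Section restrict_to_measurable.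
Local Open Scope ereal_scope.
Context d (T : measurableType d) (R : realType) (mu : probability T R).

Definition mrestr_measurable (A : set T) : \bar R :=
  if `[< measurable A >] then mu A else 0.

Let mrestr_measurable0 : mrestr_measurable set0 = 0.
Proof. by rewrite /mrestr_measurable asboolT. Qed.

Let mrestr_measurable_ge0 A : 0 <= mrestr_measurable A.
Proof. by rewrite /mrestr_measurable; case: ifPn. Qed.

Let mrestr_measurable_sigma_additive : semi_sigma_additive mrestr_measurable.
Proof.
move=> F mF tF mUF; rewrite {2}/mrestr_measurable asboolT//.
rewrite [X in X @ \oo --> _](_ : _ = (fun n => \sum_(0 <= i < n) mu (F i))).
  exact: measure_semi_sigma_additive.
apply/funext => n; apply: eq_bigr => i _.
by rewrite /mrestr_measurable asboolT.
Qed.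

HB.instance Definition _ := isMeasure.Build _ _ _ mrestr_measurable
  mrestr_measurable0 mrestr_measurable_ge0 mrestr_measurable_sigma_additive.

Let mrestr_measurableT : mrestr_measurable setT = 1.
Proof. by rewrite /mrestr_measurable asboolT ?probability_setT. Qed.

HB.instance Definition _ :=
  Measure_isProbability.Build _ _ _ mrestr_measurable mrestr_measurableT.

End restrict_to_measurable.

Section wspace_of.
Context (R : realType) (p : R) (E : normedModType R).
Variable mu : probability (borel E) R.

Lemma moment_mrestr : moment p (mrestr_measurable mu) = moment p mu.
Proof.
by apply: eq_measure_integral => A mA _; rewrite /= /mrestr_measurable asboolT.
Qed.

Lemma mrestr_null (A : set (borel E)) :
  ~ measurable A -> mrestr_measurable mu A = 0%E.
Proof. by move=> mA; rewrite /mrestr_measurable asboolF. Qed.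

Lemma wspace_of_moment :
  (moment p mu < +oo)%E -> (moment p (mrestr_measurable mu) < +oo)%E.
Proof. by rewrite moment_mrestr. Qed.

Definition wspace_of (mup : (moment p mu < +oo)%E) : wspace p E :=
  @WSpace R p E (mrestr_measurable mu) (wspace_of_moment mup) mrestr_null.

End wspace_of.

Section wasserstein.
Context (R : realType) (p : R) (E : normedModType R).
Implicit Types P Q : wspace p E.

(* For separable E, the product sigma-algebra used here is the Borel
   sigma-algebra of E * E. *)
Definition coupling P Q (g : probability (borel E * borel E)%type R) : Prop :=
  forall A : set (borel E), measurable A ->
    g (A `*` setT) = P A /\ g (setT `*` A) = Q A.

Definition wasserstein P Q : \bar R :=
  poweR (ereal_inf [set (\int[g]_z (`|(z.1 : E) - (z.2 : E)| `^ p)%:E)%E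
                   | g in coupling P Q]) p^-1.

(* Open sets for the distance W_p; with this topology, open, closed, compact
   and continuous on P_p(E) refer to W_p. *)
Definition wasserstein_open : set (set (wspace p E)) :=
  [set U | forall P, U P -> exists2 e : R, 0 < e &
             forall Q, (wasserstein P Q < e%:E)%E -> U Q].

Lemma wasserstein_openT : wasserstein_open setT.
Proof. by move=> P _; exists 1. Qed.

Lemma wasserstein_openI : setI_closed wasserstein_open.
Proof.
move=> U V oU oV P [/oU[e e0 eU] /oV[f f0 fV]].
exists (Num.min e f); first by rewrite lt_min e0.
move=> Q PQ; split; [apply: eU|apply: fV]; apply: lt_le_trans PQ _;
  by rewrite lee_fin ge_min lexx ?orbT.
Qed.

Lemma wasserstein_open_bigU (I : Type) (f : I -> set (wspace p E)) :
  (forall i, wasserstein_open (f i)) -> wasserstein_open (\bigcup_i f i).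
Proof.
move=> of_ P [i _ /of_[e e0 eU]]; exists e => // Q /eU fiQ; by exists i.
Qed.

HB.instance Definition _ := isOpenTopological.Build (wspace p E)
  wasserstein_openT wasserstein_openI wasserstein_open_bigU.

End wasserstein.

Section laws.
Context (R : realType) (p : R) (E : normedModType R).

Section empirical_measure.
Context (n : nat) (x : 'I_n.+1 -> E).
Local Open Scope ereal_scope.

Definition empirical_measure (A : set (borel E)) : \bar R :=
  (n.+1%:R^-1)%R%:E * \sum_(i < n.+1) \d_(x i : borel E) A.

Let empirical_measureE : empirical_measure =
  mscale (n.+1%:R^-1%:nng)%R (msum (fun i => \d_(x (inord i) : borel E)) n.+1).
Proof.
apply/funext => A; rewrite /mscale /msum /=; congr (_ * _).
by apply: eq_bigr => i _; rewrite inord_val.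
Qed.

Let empirical_measure0 : empirical_measure set0 = 0.
Proof. by rewrite empirical_measureE measure0. Qed.

Let empirical_measure_ge0 A : 0 <= empirical_measure A.
Proof. by rewrite empirical_measureE. Qed.

Let empirical_measure_sigma_additive : semi_sigma_additive empirical_measure.
Proof. by rewrite empirical_measureE; exact: measure_semi_sigma_additive. Qed.

HB.instance Definition _ := isMeasure.Build _ _ _ empirical_measure
  empirical_measure0 empirical_measure_ge0 empirical_measure_sigma_additive.

Let empirical_measureT : empirical_measure setT = 1.
Proof.
rewrite /empirical_measure (eq_bigr (fun=> 1%:E)); last first.
  by move=> i _; rewrite diracT.
rewrite sumEFin sumr_const card_ord -EFinM mulVf//.
Qed.

HB.instance Definition _ :=
  Measure_isProbability.Build _ _ _ empirical_measure empirical_measureT.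

Lemma empirical_moment : moment p empirical_measure < +oo.
Proof.
rewrite /moment (eq_measure_integral
  (mscale (n.+1%:R^-1%:nng)%R (msum (fun i => \d_(x (inord i) : borel E)) n.+1)));
  last by move=> A mA _; rewrite /= empirical_measureE.
have f0 (y : borel E) : [set: borel E] y -> 0 <= (`|y : E| `^ p)%:E.
  by rewrite lee_fin powR_ge0.
have mf := @measurable_norm_powR R E p.
rewrite (ge0_integral_mscale _ measurableT)// ge0_integral_measure_sum//.
rewrite lte_mul_pinfty ?lee_fin//.
apply: lte_sum_pinfty => i _.
by rewrite (integral_dirac _ measurableT mf) diracT mul1e ltry.
Qed.

(* pi(x_1, ..., x_N) with N = n.+1 *)
Definition empirical : wspace p E := wspace_of empirical_moment.

End empirical_measure.

HB.instance Definition _ :=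
  isPointed.Build (wspace p E) (@empirical 0 (fun=> 0)).

End laws.

Section random_variables.
Context d (Omega : measurableType d) (R : realType) (Pr : probability Omega R).
Context (p : R) (E : normedModType R).

Record Lp_rv := LpRV {
  rv :> {mfun Omega >-> borel E} ;
  rv_moment : (moment p (distribution Pr rv) < +oo)%E }.

Definition law (X : Lp_rv) : wspace p E := wspace_of (rv_moment X).

End random_variables.

Section stopped_law.
Context (R : realType) (T : {posnum R}) (k : nat) (p : R) (p1 : 1 <= p).
Implicit Types (x : cpath T k) (P : wspace p (cpath T k)).

Lemma stop_continuous (t : R) : continuous (@stop R T k t).
Proof.
move=> x; apply/(@cvgrPdist_le _ _ _ (nbhs x)) => e e0; near=> y.
have -> : stop t x - stop t y = stop t (x - y) by exact: val_inj.
apply: (@le_trans _ _ `|x - y|).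
  by rewrite !cpath_normE; apply: sup_norm_le => s; exact: (le_sup_norm _ (Num.min s t)).
by near: y; apply: cvgr_dist_le.
Unshelve. all: by end_near. Qed.

Lemma norm_stop (t : R) x : `|stop t x| <= `|x|.
Proof.
by rewrite !cpath_normE; apply: sup_norm_le => s; exact: (le_sup_norm _ (Num.min s t)). Qed.

Definition stop_borel (t : R) (x : borel (cpath T k)) : borel (cpath T k) :=
  stop t x.

Lemma measurable_stop (t : R) : measurable_fun setT (stop_borel t).
Proof. by apply: continuous_borel; exact: stop_continuous. Qed.

HB.instance Definition _ (t : R) :=
  isMeasurableFun.Build _ _ _ _ (stop_borel t) (measurable_stop t).

Lemma stop_moment (t : R) P : (moment p (distribution P (stop_borel t)) < +oo)%E.
Proof.
rewrite /moment ge0_integral_distribution; last 2 first.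
- exact: measurable_norm_powR.
- by move=> x; rewrite lee_fin powR_ge0.
apply: le_lt_trans (wspace_moment P); apply: ge0_le_integral => //.
- by move=> x _; rewrite lee_fin powR_ge0.
- by apply: measurableT_comp; [exact: measurable_norm_powR|exact: measurable_stop].
- exact: measurable_norm_powR.
- move=> x _; rewrite lee_fin ge0_ler_powR ?nnegrE ?norm_stop//.
  exact: le_trans p1.
Qed.

Definition stop_law (t : R) P : wspace p (cpath T k) :=
  wspace_of (stop_moment t P).

End stopped_law.

Section equations.
Context (R : realType) (T : {posnum R}) (p : R).

(* Assumption on a coefficient c : [0,T] x C^d x P_p(C^d) -> V; only the values
   of c at times in [0,T] are constrained. *)
Definition coefficient_continuous (k : nat) (V : normedModType R)
    (c : R -> cpath T k -> wspace p (cpath T k) -> V) : Prop :=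
  {within [set u : R * (cpath T k * wspace p (cpath T k)) |
             u.1 \in `[0, T%:num]],
   continuous (fun u => c u.1 u.2.1 u.2.2)}.

(* Lipschitz for the sum distance on the product; another product distance only
   changes L. *)
Definition coefficient_lipschitz (p1 : 1 <= p) (k : nat) (V : normedModType R)
    (c : R -> cpath T k -> wspace p (cpath T k) -> V) : Prop :=
  exists L : R, 0 < L /\
  exists cbar : R -> cpath T k -> wspace p (cpath T k) -> V,
    (forall s t x y P Q, s \in `[0, T%:num] -> t \in `[0, T%:num] ->
      (`|cbar s x P - cbar t y Q|%:E <=
         L%:E * ((`|s - t| + `|x - y|)%:E + wasserstein P Q))%E) /\
    (forall t x P, t \in `[0, T%:num] ->
      c t x P = cbar t (stop t x) (stop_law p1 t P)).

Definition coefficient_bounded (k : nat) (V : normedModType R)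
    (c : R -> cpath T k -> wspace p (cpath T k) -> V) : Prop :=
  exists M : R, 0 < M /\
    forall t x P, t \in `[0, T%:num] -> `|c t x P| <= M.

Context (d d' : nat).
Variable b : R -> cpath T d -> wspace p (cpath T d) -> 'cV[R]_d.
Variable sigma : R -> cpath T d -> wspace p (cpath T d) -> 'M[R]_(d, d').
Variable h : R.

(* f^{h,P}_t(zeta, w, x), where th is t_h = h * floor (t / h); it is only used
   for t in [0,T]. *)
Definition euler_map (P : wspace p (cpath T d)) (zeta : 'cV[R]_d)
    (w : cpath T d') (x : cpath T d) (t : R) : 'cV[R]_d :=
  let n := Num.truncn (t / h) in
  let th := n%:R * h in
  zeta + (t - th) *: b th x P + sigma th x P *m (w t - w th)
  + \sum_(0 <= i < n)
      (h *: b (i%:R * h) x P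
       + sigma (i%:R * h) x P *m (w (i.+1%:R * h) - w (i%:R * h))).

Definition mkv_solution disp (Omega : measurableType disp)
    (Pr : probability Omega R) (Z : Lp_rv Pr p ('cV[R]_d * cpath T d')%type)
    (X : Lp_rv Pr p (cpath T d)) : Prop :=
  {ae Pr, forall omega, forall t, t \in `[0, T%:num] ->
     (X omega : cpath T d) t =
     euler_map (law X) (Z omega).1 (Z omega).2 (X omega) t}.

Definition particle_solution disp (Omega : measurableType disp)
    (Pr : probability Omega R) (n : nat)
    (Z : 'I_n.+1 -> Lp_rv Pr p ('cV[R]_d * cpath T d')%type)
    (X : 'I_n.+1 -> {mfun Omega >-> borel (cpath T d)}) : Prop :=
  {ae Pr, forall omega, forall i t, t \in `[0, T%:num] ->
     (X i omega : cpath T d) t =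
     euler_map (empirical p (fun j => X j omega))
       (Z i omega).1 (Z i omega).2 (X i omega) t}.

(* The map L(zeta, W) |-> L(X^h): a law Q determines at most one law P of
   solutions, whatever the probability space carrying the input, so that get
   returns it. *)
Definition Psi (Q : wspace p ('cV[R]_d * cpath T d')%type) :
    wspace p (cpath T d) :=
  get [set P | exists disp (Omega : measurableType disp)
                 (Pr : probability Omega R)
                 (Z : Lp_rv Pr p ('cV[R]_d * cpath T d')%type)
                 (X : Lp_rv Pr p (cpath T d)),
                 [/\ law Z = Q, mkv_solution Z X & law X = P]].

End equations.

Section large_deviations.
Local Open Scope ereal_scope.
Context (R : realType) (S : topologicalType).

Definition good_rate_function (I : S -> \bar R) : Prop :=
  (forall x, 0 <= I x) /\ forall a : R, compact [set x | I x <= a%:E].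

(* LDP at speed N for the probability measures mu_N, N >= 1, where mu n stands
   for mu_(n.+1). Only the values of mu n on open and closed sets matter, so a
   law can be given as the set function pushforward Pr f. *)
Definition LDP (mu : nat -> set S -> \bar R) (I : S -> \bar R) : Prop :=
  [/\ good_rate_function I,
      forall A, closed A ->
        limn_esup (fun n => (n.+1%:R^-1)%R%:E * lne (mu n A))
          <= - ereal_inf (I @` A) &
      forall A, open A ->
        - ereal_inf (I @` A)
          <= limn_einf (fun n => (n.+1%:R^-1)%R%:E * lne (mu n A))].

End large_deviations.

(* Main.v *)
Require Import Defs.
From HB Require Import structures.
From mathcomp Require Import all_boot all_order all_algebra.
From mathcomp Require Import all_classical all_reals all_analysis.
From mathcomp Require Import measurable_realfun lra ring.
Set Implicit Arguments.
Unset Strict Implicit.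
Unset Printing Implicit Defensive.
Import Order.TTheory GRing.Theory Num.Theory.
Import numFieldNormedType.Exports.
Local Open Scope classical_set_scope.
Local Open Scope ring_scope.

(** The law of the solution of the discretised equation is a continuous function
    [Psi] of the law of the input, and the empirical measure of the particle
    system is the image under this same function of the empirical measure of
    its inputs: for a fixed outcome, a solution of the particle system is a
    solution of the McKean-Vlasov equation whose probability space is the set
    of labels with the uniform measure ([particle_empirical]). Part (i) is then
    the continuity of [Psi] at the law of the limit input, and part (ii) is the
    contraction principle.

    Formula for [Psi]. Written as a map of paths, the scheme is causal with a
    delay: up to time (k+1)h it reads the path and the law only up to time kh
    ([euler_path_causal]). Picard iteration from the constant path zeta
    therefore stops changing on [0, kh] after k steps, and on [0, T] after
    finitely many steps. The k-th iterate [picard k Q] is a continuous function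
    of linear growth of the input; it depends on the law [Q] of the input
    through the laws of the previous iterates. Every solution agrees almost
    surely with the last iterate ([solution_picard]), so [Psi Q] is the image
    of [Q] under it ([PsiE]).

    Continuity of [Psi]. Take two inputs [Z], [Z'] on one space, with laws [Q']
    and [Q]. By induction on k, the k-th iterates are close in L^p as soon as
    [Z] and [Z'] are ([picard_stable]). The scheme is not Lipschitz, because
    of the product of sigma with the noise: this is where the boundedness of
    sigma enters. The error (sigma(x) - sigma(x')) w' is at most a constant
    times min(1, |x - x'|) |w'|, hence at most rho |x - x'| where |w'| <= rho,
    and elsewhere it is controlled by the tail of |w'|^p, which depends only on
    the fixed law [Q] and not on the coupling ([powR_step_bound],
    [tail_powR_small]).

    Two points of topology and measurability. Each estimate compares two laws
    through a single coupling, so the gluing of couplings, and with it the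
    triangle inequality of W_p, can be avoided; the contraction principle
    asks for Hausdorff spaces, and integrals of bounded Lipschitz functions
    separate the laws by open sets ([wspace_hausdorff]). Separability of the
    path spaces makes distances between random paths measurable, and also the
    events that an empirical measure lies in a given open or closed set. *)

(** * Separability *)

Section separability.
Context (R : realType).

Definition separable (E : normedModType R) : Prop :=
  exists D : nat -> E, forall (x : E) (e : R), 0 < e -> exists n, `|x - D n| < e.

(** Choosing one point in each set of a countable cover by small sets: no
    explicit dense family has to be written down. *)
Lemma separable_of_cover (E : normedModType R) (I : countType)
    (S : I -> set E) :
  (forall (x : E) (e : R), 0 < e ->
     exists i, S i x /\ forall y, S i y -> `|x - y| < e) ->
  separable E.
Proof.
move=> cov; exists (fun n => if unpickle n is Some i then xget 0 (S i) else 0).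
move=> x e /(cov x)[i [Six Si]]; exists (pickle i); rewrite pickleK.
by apply: Si; exact: xgetI Six.
Qed.

Lemma separable_image (E : normedModType R) (I : countType) (f : I -> E) :
  (forall (x : E) (e : R), 0 < e -> exists i, `|x - f i| < e) ->
  separable E.
Proof.
move=> df; exists (fun n => if unpickle n is Some i then f i else 0).
by move=> x e /(df x)[i xi]; exists (pickle i); rewrite pickleK.
Qed.

Lemma separable_prod (E F : normedModType R) :
  separable E -> separable F -> separable (E * F)%type.
Proof.
move=> [D HD] [D' HD'].
apply: (@separable_image _ (nat * nat)%type (fun i => (D i.1, D' i.2))).
move=> [x y] e e0; have [n xn] := HD x _ e0; have [m ym] := HD' y _ e0.
by exists (n, m); rewrite [ltLHS]/(Num.max _ _) /= gt_max xn ym.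
Qed.

Lemma separable_cV (k : nat) : separable 'cV[R]_k.
Proof.
apply: (@separable_image _ 'cV[rat]_k (fun q => map_mx ratr q)) => x e e0.
have dq (r : R) : exists q : rat, `|r - ratr q| < e.
  have /rat_in_itvoo[q] : r - e < r + e by lra.
  by rewrite in_itv /= => /andP[q1 q2]; exists q; rewrite ltr_distlC q1 q2.
have /choice[f Hf] := fun i => dq (x i 0).
exists (\col_i f i); rewrite [ltLHS]mx_normrE; apply/bigmax_ltP; split => // -[i j] _.
by rewrite !mxE ord1.
Qed.

Lemma cpath_unif_continuous (T : {posnum R}) k (x : cpath T k) (e : R) :
  0 < e -> exists2 dl : R, 0 < dl & forall s t, s \in `[0, T%:num] ->
    `|t - s| < dl -> `|x s - x t| < e.
Proof.
move=> e0.
have key (s0 : R) : \forall s \near s0 & dl \near 0^'+, forall t,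
    `|t - s| < dl -> `|x s - x t| < e.
  have [|r /= r0 Hr] := (@cvgrPdist_lt _ _ _ _ _ _ _).1
    (@cpath_continuous _ _ _ x s0) (e / 2); first by rewrite divr_gt0.
  have {}Hr (u : R) : `|s0 - u| < r -> `|x s0 - x u| < e / 2 by exact: Hr.
  exists (ball s0 (r / 2), [set dl | dl < r / 2]) => /=.
    split; first by apply: nbhsx_ballx; rewrite divr_gt0.
    by apply: nbhs_right_lt; rewrite divr_gt0.
  move=> [s dl] [/=]; rewrite /ball /= => s0s dlr t ts.
  have h1 : `|x s0 - x s| < e / 2 by apply: Hr => /=; lra.
  have h2 : `|x s0 - x t| < e / 2.
    have : `|s0 - t| <= `|s0 - s| + `|t - s| by rewrite (distrC t s) ler_distD.
    by move=> h; apply: Hr; lra.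
  apply: le_lt_trans (ler_distD (x s0) _ _) _; rewrite (distrC (x s)).
  by rewrite [ltRHS]splitr ltrD.
have /compact_near_coveringP cov := @segment_compact _ 0 T%:num.
have [|dl0 /= dl0_gt0 H] := cov R (0^'+) (fun dl s => forall t, `|t - s| < dl ->
    `|x s - x t| < e) _; first by move=> s0 _; exact: key.
exists (dl0 / 2) => [|s t sT ts]; first by rewrite divr_gt0.
by apply: (H (dl0 / 2)) ts => //=; rewrite ?divr_gt0// sub0r normrN gtr0_norm ?divr_gt0//; lra.
Qed.

(** The sets of the cover prescribe a path up to [1 / (m + 1)] by values taken in
    a countable dense set on the cells of a grid; uniform continuity puts every
    path into such a set. *)
Lemma separable_cpath (T : {posnum R}) k : separable (cpath T k).
Proof.
have [D HD] := separable_cV k.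
pose S (i : nat * seq nat * nat) : set (cpath T k) :=
  let: (N, s, m) := i in [set x | forall t : R, t \in `[0, T%:num] ->
  `|x t - D (nth 0%N s (Num.truncn (t * N.+1%:R)))| <= m.+1%:R^-1].
apply: (@separable_of_cover _ _ S) => x e e0.
have [m me] : exists m : nat, m.+1%:R^-1 < e / 4.
  have /ltr_add_invr[m] : 0 < e / 4 by rewrite divr_gt0.
  by rewrite add0r; exists m.
have m0 : 0 < m.+1%:R^-1 :> R by rewrite invr_gt0.
have [dl dl0 Hdl] := cpath_unif_continuous x (divr_gt0 m0 (ltr0Sn R 1)).
have [N Ndl] : exists N : nat, N.+1%:R^-1 < dl.
  by have /ltr_add_invr[N] := dl0; rewrite add0r; exists N.
have /choice[f Hf] : forall i : nat, exists j,
    `|x (i%:R / N.+1%:R) - D j| < m.+1%:R^-1 / 2.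
  by move=> i; apply: HD; rewrite divr_gt0.
exists (N, mkseq f (Num.truncn (T%:num * N.+1%:R)).+1, m).
have xf (t : R) : t \in `[0, T%:num] -> `|x t - D (nth 0%N
    (mkseq f (Num.truncn (T%:num * N.+1%:R)).+1) (Num.truncn (t * N.+1%:R)))|
    <= m.+1%:R^-1.
  rewrite in_itv /= => /andP[t0 tT].
  rewrite nth_mkseq; last by rewrite ltnS le_truncn// ler_wpM2r.
  set i := Num.truncn _; have := Hf i.
  have : `|x t - x (i%:R / N.+1%:R)| < m.+1%:R^-1 / 2.
    apply: Hdl; first by rewrite in_itv /= t0.
    apply: le_lt_trans Ndl.
    have /andP[i1 i2] : i%:R <= t * N.+1%:R < i.+1%:R.
      by apply: truncn_itv; rewrite ?mulr_ge0.
    have N0 : 0 < N.+1%:R :> R by rewrite ltr0n.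
    rewrite distrC ger0_norm; last by rewrite subr_ge0 ler_pdivrMr.
    have -> : t - i%:R / N.+1%:R = (t * N.+1%:R - i%:R) / N.+1%:R.
      by rewrite mulrBl mulfK ?gt_eqF.
    rewrite -[leRHS]mul1r ler_pM2r ?invr_gt0// lerBlDl.
    by move: i2; rewrite -[i.+1%:R]natr1 => /ltW.
  move=> h1 h2; apply: le_trans (ler_distD (x (i%:R / N.+1%:R)) _ _) _.
  by rewrite [leRHS]splitr; apply: lerD; exact: ltW.
split => // y Sy.
suff : `|x - y| <= e / 2 by lra.
rewrite cpath_normE; apply: sup_norm_le => t; rewrite [(x - y) t]/(x t - y t).
rewrite (cpath_clamp x) (cpath_clamp y).
have := Sy _ (clamp_itv T t); have := xf _ (clamp_itv T t).
set q := D _ => xq yq.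
apply: le_trans (ler_distD q _ _) _; rewrite (distrC q).
apply: le_trans (lerD xq yq) _; have -> : e / 2 = e / 4 + e / 4 by lra.
by rewrite lerD// ltW.
Qed.

End separability.

(** * Measurability from separability *)

Section measurability.
Context (R : realType) (E : normedModType R) (sepE : separable E).
Context disp (Omega : measurableType disp).

Lemma measurable_norm_lt (f : Omega -> borel E) (q : E) (r : R) :
  measurable_fun setT f -> measurable [set w | `|(f w : E) - q| < r].
Proof.
move=> mf; rewrite -[X in measurable X]setTI.
apply: (mf _ [set x : E | `|x - q| < r]) => //.
apply: open_measurable_borel; rewrite (_ : [set x | _] = ball q r).
  exact: ball_open.
by apply/seteqP; split => x; rewrite -ball_normE /= distrC.
Qed.

(** The distance is less than [r] exactly when some point of the dense sequence
    and some rational witness it through the triangle inequality, which makes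
    the event a countable union. *)
Lemma measurable_dist (f g : Omega -> borel E) :
  measurable_fun setT f -> measurable_fun setT g ->
  measurable_fun setT (fun w => `|(f w : E) - (g w : E)|).
Proof.
move=> mf mg; have [D HD] := sepE.
apply: (measurability _ (RGenInftyO.measurableE R)).
move=> _ [_ [r ->] <-]; rewrite setTI.
rewrite (_ : _ @^-1` _ = \bigcup_(i : nat * rat)
    ([set w | `|(f w : E) - D i.1| < ratr i.2] `&`
     [set w | `|(g w : E) - D i.1| < r - ratr i.2])).
  apply: countable_bigcupT_measurable => // i.
  by apply: measurableI; exact: measurable_norm_lt.
apply/seteqP; split => [w /=|w [[n q] _ /= [fq gq]]]; rewrite in_itv /=.
  move=> fg; have eta0 : 0 < (r - `|(f w : E) - g w|) / 3.
    by rewrite divr_gt0// subr_gt0.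
  have [n fn] := HD (f w) _ eta0.
  have /rat_in_itvoo[q] := fn; rewrite in_itv /= => /andP[q1 q2].
  exists (n, q) => //=; split => //.
  apply: le_lt_trans (ler_distD (f w : E) _ _) _; rewrite (distrC (g w : E)).
  set a := `|_ - _| in q1 q2 fg eta0 fn *; set c := `|_ - _| in q1 q2 fg eta0 fn *.
  lra.
apply: le_lt_trans (ler_distD (D n) _ _) _; rewrite (distrC (D n)).
by apply: lt_le_trans (ltrD fq gq) _; rewrite addrC subrK.
Qed.

Lemma measurable_dist_powR (p : R) (f g : Omega -> borel E) :
  measurable_fun setT f -> measurable_fun setT g ->
  measurable_fun setT (fun w => (`|(f w : E) - (g w : E)| `^ p)%:E).
Proof.
move=> mf mg; apply/measurable_EFinP.
by apply: (measurableT_comp (measurable_powR p)); exact: measurable_dist.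
Qed.

(** For separable [E] every open set of [E ^ n] is a countable union of boxes,
    so it is measurable for the product of the Borel sigma-algebras. *)
Lemma measurable_open_tuple n (f : 'I_n -> Omega -> borel E)
    (U : set ('I_n -> E)) :
  (forall i, measurable_fun setT (f i)) ->
  (forall x, U x -> exists2 r : R, 0 < r &
     forall y, (forall i, `|x i - y i| < r) -> U y) ->
  measurable [set w | U (fun i => f i w)].
Proof.
move=> mf oU; have [D HD] := sepE.
pose box (j : {ffun 'I_n -> nat} * nat) : set ('I_n -> E) :=
  [set y | forall i, `|y i - D (j.1 i)| < j.2.+1%:R^-1].
rewrite (_ : [set w | _] =
    \bigcup_(j in [set j | box j `<=` U]) [set w | box j (fun i => f i w)]).
  rewrite bigcup_mkcond; apply: countable_bigcupT_measurable => // j.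
  case: ifP => // _.
  rewrite (_ : [set w | _] = \big[setI/setT]_(i < n)
     [set w | `|(f i w : E) - D (j.1 i)| < j.2.+1%:R^-1]).
    by apply: bigsetI_measurable => i _; exact: measurable_norm_lt.
  rewrite -bigcap_seq; apply/seteqP; split => w /= H i; first by move=> _; exact: H.
  by apply: H; rewrite /= mem_index_enum.
apply/seteqP; split => [w /= Uw|w [j] /= jU]; last exact: jU.
have [r r0 Ur] := oU _ Uw.
have [m mr] : exists m : nat, m.+1%:R^-1 < r / 2.
  have /ltr_add_invr[m] : 0 < r / 2 by rewrite divr_gt0.
  by rewrite add0r; exists m.
have /choice[k Hk] : forall i, exists k, `|(f i w : E) - D k| < m.+1%:R^-1.
  by move=> i; apply: HD; rewrite invr_gt0.
exists ([ffun i => k i], m) => /= [y|i]; last by rewrite ffunE.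
move=> ym; apply: Ur => i; have := ym i; rewrite ffunE => ymi.
apply: le_lt_trans (ler_distD (D (k i)) _ _) _; rewrite (distrC (D (k i))).
by rewrite [ltRHS]splitr; apply: ltrD; exact: lt_trans mr.
Qed.

End measurability.

(** * The spaces of laws *)

Section powR_facts.
Context (R : realType).
Implicit Types x y r p : R.

Lemma powRVK p x : 1 <= p -> 0 <= x -> (x `^ p^-1) `^ p = x.
Proof.
by move=> p1 x0; rewrite -powRrM mulVf ?powRr1// gt_eqF// (lt_le_trans ltr01).
Qed.

Lemma powRKV p x : 1 <= p -> 0 <= x -> (x `^ p) `^ p^-1 = x.
Proof.
by move=> p1 x0; rewrite -powRrM divff ?powRr1// gt_eqF// (lt_le_trans ltr01).
Qed.

Lemma powR_le p x y : 1 <= p -> 0 <= x -> x <= y -> x `^ p <= y `^ p.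
Proof.
move=> p1 x0 xy; apply: ge0_ler_powR; rewrite ?nnegrE//.
  exact: le_trans ler01 p1.
exact: le_trans xy.
Qed.

End powR_facts.

Section measure_facts.
Context (R : realType) d (T : measurableType d) (mu : {measure set T -> \bar R}).

Lemma ae_le_measure (A B : set T) : measurable A -> measurable B ->
  {ae mu, forall w, A w -> B w} -> (mu A <= mu B)%E.
Proof.
move=> mA mB [N [mN N0 AB]].
apply: (@le_trans _ _ (mu (B `|` N))).
  rewrite le_measure ?inE//; first exact: measurableU.
  move=> w Aw; have [|nB] := pselect (B w); [by left|right].
  by apply: AB => /= /(_ Aw).
by rewrite -[leRHS]adde0 -N0 measureU2.
Qed.

Lemma ae_eq_measure (A B : set T) : measurable A -> measurable B ->
  {ae mu, forall w, A w <-> B w} -> mu A = mu B.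
Proof.
move=> mA mB AB; apply/eqP; rewrite eq_le.
by apply/andP; split; apply: ae_le_measure => //; apply: filterS AB => w [].
Qed.

End measure_facts.

Section wspace_theory.
Context (R : realType).

(** All the other fields of a probability are proofs. *)
Lemma probability_eq d (T : measurableType d) (mu nu : probability T R) :
  (mu : set T -> \bar R) = nu -> mu = nu.
Proof.
case: mu => m [[a1 a1'] [a2] [a3] [a4] [a5] [a6] [a7]].
case: nu => n [[b1 b1'] [b2] [b3] [b4] [b5] [b6] [b7]] /= mn; subst n.
by rewrite (Prop_irrelevance a1 b1) (Prop_irrelevance a1' b1')
  (Prop_irrelevance a2 b2) (Prop_irrelevance a3 b3) (Prop_irrelevance a4 b4)
  (Prop_irrelevance a5 b5) (Prop_irrelevance a6 b6) (Prop_irrelevance a7 b7).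
Qed.

Context (p : R) (p1 : 1 <= p) (E : normedModType R).
Implicit Types P Q : wspace p E.

Lemma wspace_eq P Q :
  (forall A : set (borel E), measurable A -> P A = Q A) -> P = Q.
Proof.
case: P => m mp m0; case: Q => n np n0 /= mn.
have e : m = n.
  apply: probability_eq; apply/funext => A.
  by have [/mn//|nA] := pselect (measurable A); rewrite m0// n0.
by subst n; congr WSpace; exact: Prop_irrelevance.
Qed.

Lemma wspace_ofE (mu : probability (borel E) R) mup (A : set (borel E)) :
  measurable A -> @wspace_of _ p _ mu mup A = mu A.
Proof. by move=> mA; rewrite /= /mrestr_measurable asboolT. Qed.

Section coupled.
Context disp (Omega : measurableType disp) (Pr : probability Omega R).

(** The comparison stops at measurable sets: elsewhere the value of a measure
    carries no information. *)
Definition has_law (f : Omega -> borel E) P : Prop :=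
  measurable_fun setT f /\ forall A, measurable A -> P A = Pr (f @^-1` A).

Definition lp_cost (f g : Omega -> borel E) : \bar R :=
  (\int[Pr]_w (`|(f w : E) - (g w : E)| `^ p)%:E)%E.

Lemma has_law_law (X : Lp_rv Pr p E) : has_law X (law X).
Proof. by split; [exact: measurable_funP|move=> A mA; rewrite wspace_ofE]. Qed.

Lemma has_law_unique (f : Omega -> borel E) P Q :
  has_law f P -> has_law f Q -> P = Q.
Proof. by move=> [_ fP] [_ fQ]; apply: wspace_eq => A mA; rewrite fP// fQ. Qed.

Lemma has_law_ae (f g : Omega -> borel E) P Q : has_law f P -> has_law g Q ->
  {ae Pr, forall w, f w = g w} -> P = Q.
Proof.
move=> [mf fP] [mg gQ] fg; apply: wspace_eq => A mA; rewrite fP// gQ//.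
apply: ae_eq_measure; last by apply: filterS fg => w /= ->.
- by rewrite -[_ @^-1` _]setTI; exact: mf.
- by rewrite -[_ @^-1` _]setTI; exact: mg.
Qed.

Lemma ge0_integral_has_law (f : Omega -> borel E) P (phi : borel E -> \bar R) :
  has_law f P -> measurable_fun setT phi -> (forall x, 0 <= phi x)%E ->
  (\int[P]_x phi x = \int[Pr]_w phi (f w))%E.
Proof.
move=> [mf fP] mphi phi0.
rewrite (@eq_measure_integral _ _ _ _ (pushforward Pr f)).
  by rewrite ge0_integral_pushforward.
by move=> A mA _; exact: fP.
Qed.

Lemma wasserstein_le (sepE : separable E) (f g : Omega -> borel E) P Q (r : R) :
  has_law f P -> has_law g Q -> 0 <= r -> (lp_cost f g <= (r `^ p)%:E)%E ->
  (wasserstein P Q <= r%:E)%E.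
Proof.
move=> [mf fP] [mg gQ] r0 fgr.
have p0 : 0 < p by exact: lt_le_trans p1.
have mX : measurable_fun setT (fun w => (f w, g w)) by exact/measurable_fun_pair.
pose X : {mfun Omega >-> (borel E * borel E)%type} :=
  HB.pack (fun w => (f w, g w)) (isMeasurableFun.Build _ _ _ _ _ mX).
have cX : coupling P Q (distribution Pr X).
  by move=> A mA; rewrite fP// gQ// /= /pushforward; split; congr (Pr _);
    apply/seteqP; split => w /=; rewrite /setX /=; tauto.
have -> : r%:E = poweR (r `^ p)%:E p^-1 by rewrite poweR_EFin powRKV.
rewrite /wasserstein; apply: gt0_ler_poweR.
- by rewrite invr_ge0 ltW.
- rewrite in_itv /= leey andbT; apply: le_ereal_inf_tmp => _ [gm _ <-].
  by apply: integral_ge0 => x _; rewrite lee_fin powR_ge0.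
- by rewrite in_itv /= leey andbT lee_fin powR_ge0.
apply: le_trans fgr; apply: ereal_inf_lbound; exists (distribution Pr X) => //.
rewrite ge0_integral_distribution//.
  by apply: (measurable_dist_powR sepE); [exact: measurable_fst|exact: measurable_snd].
Qed.

End coupled.

(** A coupling with small cost is turned into two random variables on the product
    space, so that couplings need not be mentioned again. *)
Lemma wasserstein_lt P Q (e : R) : (wasserstein P Q < e%:E)%E ->
  exists (g : probability (borel E * borel E)%type R),
    [/\ has_law g fst P, has_law g snd Q &
        (lp_cost g fst snd < (e `^ p)%:E)%E].
Proof.
move=> We; have e0 : 0 <= e by rewrite -lee_fin (le_trans _ (ltW We))// poweR_ge0.
have p0 : 0 < p by exact: lt_le_trans p1.
have : (ereal_inf [set (\int[g]_z (`|(z.1 : E) - (z.2 : E)| `^ p)%:E)%E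
                   | g in coupling P Q] < (e `^ p)%:E)%E.
  rewrite ltNge; apply/negP => le_e; move: We; rewrite ltNge => /negP; apply.
  have -> : e%:E = poweR (e `^ p)%:E p^-1 by rewrite poweR_EFin powRKV.
  apply: gt0_ler_poweR => //.
  - by rewrite invr_ge0 ltW.
  - by rewrite in_itv /= leey andbT lee_fin powR_ge0.
  - by rewrite in_itv /= leey andbT (le_trans _ le_e)// lee_fin powR_ge0.
move=> /ereal_inf_lt[_ [g cg <-] ge]; exists g; split => //.
- split; first exact: measurable_fst.
  move=> A mA; rewrite -(cg A mA).1; congr (g _).
  by apply/seteqP; split => w /=; rewrite /setX /=; tauto.
- split; first exact: measurable_snd.
  move=> A mA; rewrite -(cg A mA).2; congr (g _).
  by apply/seteqP; split => w /=; rewrite /setX /=; tauto.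
Qed.

Lemma wasserstein_openE (U : set (wspace p E)) : open U = wasserstein_open U.
Proof. by []. Qed.

Lemma lp_costC d (T : measurableType d) (Pr : probability T R)
  (f g : T -> borel E) : lp_cost Pr f g = lp_cost Pr g f.
Proof. by apply: eq_integral => w _; rewrite distrC. Qed.

Lemma lipschitz_continuous (phi : E -> R) (L : R) : 0 < L ->
  (forall x y, `|phi x - phi y| <= L * `|x - y|) -> continuous phi.
Proof.
move=> L0 phiL x; apply/cvgrPdist_lt => e e0; near=> y.
apply: le_lt_trans (phiL _ _) _; rewrite mulrC -ltr_pdivlMr//.
near: y; apply/nbhs_ballP; exists (e / L) => /=; first by rewrite divr_gt0.
by move=> z; rewrite -ball_normE.
Unshelve. all: by end_near. Qed.

Section lipschitz_test.
Context (sepE : separable E) (phi : E -> R) (L : R) (L0 : 0 < L).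
Hypothesis phi01 : forall x, 0 <= phi x <= 1.
Hypothesis phiL : forall x y, `|phi x - phi y| <= L * `|x - y|.

Let mphi : measurable_fun setT (fun x : borel E => (phi x)%:E).
Proof.
by apply/measurable_EFinP; apply: continuous_borel_real;
  exact: lipschitz_continuous phiL.
Qed.

Let phi0 x : (0 <= (phi x)%:E)%E.
Proof. by rewrite lee_fin; case/andP: (phi01 x). Qed.

(** If [L * |x - y| <= eta] the two values of [phi] differ by at most [eta];
    otherwise [1 <= (L * |x - y| / eta) ^ p], as in Markov's inequality. *)
Lemma lipschitz_test_le d (T : measurableType d) (Pr : probability T R)
    (f g : T -> borel E) P Q (eta : R) :
  has_law Pr f P -> has_law Pr g Q -> 0 < eta ->
  (\int[P]_x (phi x)%:E <= \int[Q]_x (phi x)%:E + eta%:E +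
    ((L / eta) `^ p)%:E * lp_cost Pr f g)%E.
Proof.
move=> fP gQ eta0; rewrite (ge0_integral_has_law fP)// (ge0_integral_has_law gQ)//.
have [mf _] := fP; have [mg _] := gQ.
have mfg : measurable_fun setT (fun w => (`|(f w : E) - g w| `^ p)%:E).
  exact: measurable_dist_powR.
have fg0 w : (0 <= (`|(f w : E) - g w| `^ p)%:E)%E by rewrite lee_fin powR_ge0.
have c0 : (0 <= ((L / eta) `^ p)%:E)%E by rewrite lee_fin powR_ge0.
have mphif (k : T -> borel E) (mk : measurable_fun setT k) :
    measurable_fun setT (fun w => (phi (k w))%:E) by exact: (measurableT_comp mphi mk).
have -> : eta%:E = (\int[Pr]_w (eta%:E))%E.
  by rewrite integral_cst//= probability_setT mule1.
rewrite -ge0_integralZl// -ge0_integralD//; last 2 first.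
- exact: mphif.
- by move=> *; rewrite lee_fin ltW.
rewrite -ge0_integralD//; last 4 first.
- by move=> *; rewrite adde_ge0// lee_fin ltW.
- by apply: emeasurable_funD => //; exact: mphif.
- by move=> *; rewrite mule_ge0.
- exact: measurable_funeM.
apply: ge0_le_integral => //.
- exact: mphif.
- by apply: emeasurable_funD; [apply: emeasurable_funD => //; exact: mphif|
    exact: measurable_funeM].
move=> w _; change ((phi (f w))%:E <= (phi (g w) + eta +
  (L / eta) `^ p * `|(f w : E) - g w| `^ p)%:E)%E.
rewrite lee_fin -powRM//; last by rewrite divr_ge0// ltW.
have /andP[f0 f1] := phi01 (f w); have /andP[g0 g1] := phi01 (g w).
have [small|big] := leP (L * `|(f w : E) - g w|) eta.
  have h := le_trans (phiL (f w) (g w)) small.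
  have := powR_ge0 (L / eta * `|(f w : E) - g w|) p.
  move: h; rewrite ler_norml => /andP[_]; set a := _ `^ _; lra.
have : 1 <= (L / eta * `|(f w : E) - g w|) `^ p.
  have -> : 1 = 1 `^ p :> R by rewrite powR1.
  apply: powR_le => //.
  by rewrite mulrAC ler_pdivlMr// mul1r ltW.
by set a := _ `^ _; lra.
Qed.

(** [dl] is chosen so that [(L / eta) ^ p * dl ^ p = eta]. *)
Lemma lipschitz_test_near P (e : R) : 0 < e ->
  exists2 dl : R, 0 < dl & forall Q, (wasserstein P Q < dl%:E)%E ->
    (\int[P]_x (phi x)%:E <= \int[Q]_x (phi x)%:E + e%:E)%E /\
    (\int[Q]_x (phi x)%:E <= \int[P]_x (phi x)%:E + e%:E)%E.
Proof.
move=> e0; pose eta := e / 2; have eta0 : 0 < eta by rewrite divr_gt0.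
exists (eta `^ p^-1 * (eta / L)).
  by rewrite mulr_gt0 ?powR_gt0 ?divr_gt0.
move=> Q /wasserstein_lt[g [gP gQ]] cost.
have key : (((L / eta) `^ p)%:E * lp_cost g fst snd <= eta%:E)%E.
  rewrite (le_trans (lee_wpmul2l _ (ltW cost)))//; first by rewrite lee_fin powR_ge0.
  have h1 := ltW (divr_gt0 L0 eta0); have h2 := ltW (divr_gt0 eta0 L0).
  rewrite -EFinM lee_fin -powRM//; last by rewrite mulr_ge0// powR_ge0.
  have -> : L / eta * (eta `^ p^-1 * (eta / L)) = eta `^ p^-1.
    by field; rewrite !gt_eqF.
  by rewrite powRVK// ltW.
rewrite (splitr e) -/eta EFinD; split; rewrite addeA.
  by apply: le_trans (lipschitz_test_le gP gQ eta0) _; apply: leeD2l; exact: key.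
apply: le_trans (lipschitz_test_le gQ gP eta0) _.
by apply: leeD2l; rewrite lp_costC; exact: key.
Qed.

Let int_fin P : exists2 r : R, (\int[P]_x (phi x)%:E)%E = r%:E & 0 <= r.
Proof.
have i0 : (0 <= \int[P]_x (phi x)%:E)%E by apply: integral_ge0.
have i1 : (\int[P]_x (phi x)%:E <= 1)%E.
  have -> : 1%E = (\int[P]_x (1%:E))%E :> \bar R.
    by rewrite integral_cst//= probability_setT mule1.
  apply: ge0_le_integral => //.
  by move=> x _; rewrite lee_fin; case/andP: (phi01 x).
have ifin : (\int[P]_x (phi x)%:E)%E \is a fin_num.
  by rewrite ge0_fin_numE// (le_lt_trans i1)// ltry.
by exists (fine (\int[P]_x (phi x)%:E)); rewrite ?fineK// fine_ge0.
Qed.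

Lemma lipschitz_test_open (m : R) :
  open [set P : wspace p E | (\int[P]_x (phi x)%:E < m%:E)%E] /\
  open [set P : wspace p E | (m%:E < \int[P]_x (phi x)%:E)%E].
Proof.
rewrite !wasserstein_openE; split => P /=; have [r rE r0] := int_fin P; rewrite rE lte_fin => rm.
  have e0 : 0 < (m - r) / 2 by rewrite divr_gt0// subr_gt0.
  have [dl dl0 H] := lipschitz_test_near P e0; exists dl => // Q /H[_].
  rewrite rE /=; have [s -> s0] := int_fin Q; rewrite -EFinD lee_fin lte_fin; lra.
have e0 : 0 < (r - m) / 2 by rewrite divr_gt0// subr_gt0.
have [dl dl0 H] := lipschitz_test_near P e0; exists dl => // Q /H[+ _].
rewrite rE /=; have [s -> s0] := int_fin Q; rewrite -EFinD lee_fin lte_fin; lra.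
Qed.

Lemma lipschitz_test_split P Q :
  (\int[P]_x (phi x)%:E < \int[Q]_x (phi x)%:E)%E ->
  exists A B : set (wspace p E), [/\ A P, B Q, open A, open B & A `&` B = set0].
Proof.
have [r rE r0] := int_fin P; have [s sE s0] := int_fin Q.
rewrite rE sE lte_fin => rs; have [oA oB] := lipschitz_test_open ((r + s) / 2).
exists [set P : wspace p E | (\int[P]_x (phi x)%:E < ((r + s) / 2)%:E)%E].
exists [set P : wspace p E | (((r + s) / 2)%:E < \int[P]_x (phi x)%:E)%E].
split => //=; rewrite ?rE ?sE ?lte_fin; [lra|lra|].
by apply/seteqP; split => // x /= [h1 /(lt_trans h1)]; rewrite ltxx.
Qed.

End lipschitz_test.

Lemma dist_to_compl (U : set E) : open U -> ~` U !=set0 ->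
  exists dU : E -> R, [/\ (forall x, 0 <= dU x),
    (forall x y, `|dU x - dU y| <= `|x - y|),
    (forall x, ~ U x -> dU x = 0) & (forall x, U x -> 0 < dU x)].
Proof.
move=> oU [z nUz]; pose S x := [set `|x - y| | y in ~` U].
have S0 x : S x !=set0 by exists `|x - z|, z.
have lbS x : lbound (S x) 0 by move=> _ [y _ <-].
have hS x : has_inf (S x) by split => //; exists 0.
have d0 x : 0 <= inf (S x) by exact: lb_le_inf.
have dL x y : inf (S x) <= inf (S y) + `|x - y|.
  rewrite -lerBlDr; apply: lb_le_inf => // _ [v nUv <-]; rewrite lerBlDr.
  apply: (@le_trans _ _ `|x - v|); first by apply: ge_inf; [case: (hS x)|exists v].
  by rewrite [leRHS]addrC; exact: ler_distD.
exists (fun x => inf (S x)); split => //.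
- move=> x y; rewrite ler_norml; have := dL x y; have := dL y x; rewrite (distrC y x).
  by set a := `|_|; lra.
- move=> x nUx; apply/eqP; rewrite eq_le d0 andbT; apply: ge_inf.
    by case: (hS x).
  by exists x; rewrite ?subrr ?normr0.
- move=> x Ux; have /nbhs_ballP[r /= r0 rU] : nbhs x U by exact: open_nbhs_nbhs.
  apply: (lt_le_trans r0); apply: lb_le_inf => // _ [y nUy <-].
  by rewrite leNgt; apply/negP => xy; apply/nUy/rU; rewrite -ball_normE.
Qed.

(** The indicator of an open set is the increasing limit of the Lipschitz
    functions [min 1 ((n + 1) * dist)], where [dist] is the distance to the
    complement, and open sets are a pi-system that generates the Borel sets. *)
Lemma lipschitz_test_separates P Q :
  (forall (phi : E -> R) (L : R), 0 < L -> (forall x, 0 <= phi x <= 1) ->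
    (forall x y, `|phi x - phi y| <= L * `|x - y|) ->
    (\int[P]_x (phi x)%:E = \int[Q]_x (phi x)%:E)%E) ->
  P = Q.
Proof.
move=> PQ; apply: wspace_eq => A mA.
apply: (@measure_unique _ R (borel E) (@open E) (fun=> setT)) => //.
- by move=> B C; exact: openI.
- by move=> i; exact: openT.
- by rewrite bigcup_const.
- move=> U oU.
  (* The whole space has no distance to its complement, but mass one. *)
  have [/nonemptyPn/(congr1 setC)|] := pselect (~ (~` U !=set0)).
    by rewrite setCK setC0 => ->; exact: etrans (probability_setT P) (esym (probability_setT Q)).
  move=> /contrapT/(dist_to_compl oU)[dU [d0 dL dC dU0]].
  pose phi n x : R := Num.min 1 (n.+1%:R * dU x).
  have phi01 n x : 0 <= phi n x <= 1.
    by rewrite le_min ler01 ge_min lexx mulr_ge0.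
  have phiL n x y : `|phi n x - phi n y| <= n.+1%:R * `|x - y|.
    have n0 : 0 <= n.+1%:R :> R by [].
    apply: (@le_trans _ _ `|n.+1%:R * dU x - n.+1%:R * dU y|); last first.
      by rewrite -mulrBr normrM ger0_norm// ler_wpM2l.
    rewrite /phi; move: (n.+1%:R * dU x) (n.+1%:R * dU y) => u v.
    have := ler_norm (u - v); have := ler_norm (v - u); rewrite distrC ler_norml.
    have := normr_ge0 (u - v); set a := `|_| => a0 h1 h2.
    by rewrite !minElt; case: ltP => h3; case: ltP => h4; apply/andP; split; lra.
  have phiE (M : wspace p E) : M U = limn (fun n => \int[M]_x (phi n x)%:E)%E.
    have mphi n : measurable_fun setT (fun x : borel E => (phi n x)%:E).
      apply/measurable_EFinP; apply: continuous_borel_real.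
      exact: lipschitz_continuous (phiL n).
    rewrite -[U]setIT -integral_indic ?setIT//; last exact: open_measurable_borel.
    rewrite -monotone_convergence//; first last.
    - move=> x _ m n mn; rewrite lee_fin /phi le_min ge_min lexx /=.
      by rewrite ge_min ler_wpM2r ?ler_nat ?orbT.
    - by move=> n x _; rewrite lee_fin; case/andP: (phi01 n x).
    apply: eq_integral => x _; rewrite indicE; apply/esym/cvg_lim => //.
    have [Ux|nUx] := boolP (x \in U); last first.
      apply: cvg_near_cst; near=> n; rewrite /phi dC ?mulr0; last first.
        by move=> Ux; move/negP: nUx; apply; exact: mem_set.
      by rewrite min_r.
    have dx : 0 < dU x by apply: dU0; exact: set_mem.
    apply: cvg_near_cst; near=> n; rewrite /phi min_l// -ler_pdivrMr// mul1r.
    apply: (@le_trans _ _ n%:R); last by rewrite ler_nat.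
    by near: n; exact: nbhs_infty_ger.
  apply: etrans (phiE P) (etrans _ (esym (phiE Q))); congr (limn _).
  by apply/funext => n; apply: PQ (phi01 n) (phiL n).
- by move=> _; apply: le_lt_trans (probability_le1 P _) _; rewrite ?ltry.
Unshelve. all: by end_near. Qed.

Lemma wspace_hausdorff : separable E -> hausdorff_space (wspace p E).
Proof.
move=> sepE; rewrite open_hausdorff => P Q PQ.
have [phi [L [L0 phi01 phiL IPQ]]] : exists (phi : E -> R) (L : R),
   [/\ 0 < L, (forall x, 0 <= phi x <= 1),
     (forall x y, `|phi x - phi y| <= L * `|x - y|) &
     (\int[P]_x (phi x)%:E <> \int[Q]_x (phi x)%:E)%E].
  apply: contrapT => H; move/eqP: PQ; apply; apply: lipschitz_test_separates.
  move=> phi L L0 phi01 phiL; apply: contrapT => IPQ; apply: H.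
  by exists phi, L.
have [PltQ|QltP|//] := ltgtP (\int[P]_x (phi x)%:E)%E (\int[Q]_x (phi x)%:E)%E.
- have [A [B [AP BQ oA oB AB]]] := lipschitz_test_split sepE L0 phi01 phiL PltQ.
  by exists (A, B) => /=; [rewrite !inE|split => //; apply/eqP].
- have [A [B [AP BQ oA oB AB]]] := lipschitz_test_split sepE L0 phi01 phiL QltP.
  by exists (B, A) => /=; [rewrite !inE|split => //; rewrite setIC; apply/eqP].
Qed.

End wspace_theory.

(** * Contraction principle *)

Section contraction.
Context (R : realType) (S S' : ptopologicalType).
Context (hS : hausdorff_space S) (hS' : hausdorff_space S').
Context (f : S -> S') (cf : continuous f) (I : S -> \bar R).
Local Open Scope ereal_scope.

Definition image_rate (y : S') : \bar R :=
  ereal_inf [set I x | x in [set x | f x = y]].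

(** The sets where [f x = y] and [I x <= a + 1 / (n + 1)] are nonempty, nested and
    closed, the last because compact sets are closed in a Hausdorff space; a
    common point attains the infimum. *)
Lemma good_rate_attained (y : S') (a : R) :
  good_rate_function I -> image_rate y <= a%:E ->
  exists2 x, f x = y & I x <= a%:E.
Proof.
move=> [I0 cI] ya.
have lt_ex (e : R) : (0 < e)%R -> exists x, f x = y /\ I x <= (a + e)%:E.
  move=> e0; have : image_rate y < (a + e)%:E.
    by apply: le_lt_trans ya _; rewrite lte_fin ltrDl.
  by move=> /ereal_inf_lt[_ [x fx <-] /ltW Ix]; exists x.
pose B (n : nat) := [set x | f x = y /\ I x <= (a + n.+1%:R^-1)%:E].
have clB n : closed (B n).
  rewrite (_ : B n = f @^-1` [set y] `&` [set x | I x <= (a + n.+1%:R^-1)%:E]).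
    apply: closedI; last exact: compact_closed.
    by apply: closed_comp => [x _|]; [exact: cf|exact/accessible_closed_set1/hausdorff_accessible].
  by apply/seteqP; split.
have : compact (B 0%N).
  apply: subclosed_compact (clB 0%N) (cI (a + 1^-1)%R) _.
  by move=> x [].
rewrite compact_In0 => /(_ nat setT B)[||x Bx].
- exists B => // n _; apply/seteqP; split => [x Bnx|x []//]; split => //.
  case: Bnx => fx Ix; split => //; apply: le_trans Ix _.
  by rewrite lee_fin lerD2l lef_pV2 ?posrE// ler_nat.
- move=> D _; pose m := (\max_(i <- finmap.enum_fset D) i)%N.
  have [|x [fx Ix]] := lt_ex (m.+1%:R^-1)%R; first by rewrite invr_gt0.
  exists x => i /= iD; split => //; apply: le_trans Ix _.
  by rewrite lee_fin lerD2l lef_pV2 ?posrE// ler_nat ltnS leq_bigmax_seq.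
exists x; first by case: (Bx 0%N).
apply/lee_addgt0Pr => e e0; have [n ne] : exists n : nat, (n.+1%:R^-1 < e)%R.
  by have /ltr_add_invr[n] := e0; rewrite add0r; exists n.
case: (Bx n) => // _ Ix; apply: le_trans Ix _.
by rewrite -EFinD lee_fin lerD2l ltW.
Qed.

Lemma image_rate_good : good_rate_function I -> good_rate_function image_rate.
Proof.
move=> gI; have [I0 cI] := gI; split.
  by move=> y; apply: le_ereal_inf_tmp => _ [x _ <-].
move=> a; rewrite (_ : [set y | _] = f @` [set x | I x <= a%:E]).
  apply: continuous_compact (cI a); exact: continuous_subspaceT.
apply/seteqP; split => [y /(good_rate_attained gI)[x fx Ix]|_ [x Ix <-]] /=.
  by exists x.
by apply: le_trans Ix; apply: ereal_inf_lbound; exists x.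
Qed.

Lemma inf_image_rate (A : set S') :
  ereal_inf (image_rate @` A) = ereal_inf (I @` (f @^-1` A)).
Proof.
apply/eqP; rewrite eq_le; apply/andP; split.
  apply: le_ereal_inf_tmp => _ [x Afx <-].
  apply: (@le_trans _ _ (image_rate (f x))); apply: ereal_inf_lbound.
    by exists (f x).
  by exists x.
apply: le_ereal_inf_tmp => _ [y Ay <-]; apply: le_ereal_inf_tmp => _ [x fx <-].
by apply: ereal_inf_lbound; exists x => //; rewrite /preimage /= fx.
Qed.

(** An LDP tests open and closed sets only; the hypothesis on [nu] is confined to
    them because for laws of random elements only measurable events count. *)
Lemma contraction_principle (mu : nat -> set S -> \bar R)
    (nu : nat -> set S' -> \bar R) :
  (forall n A, open A \/ closed A -> nu n A = mu n (f @^-1` A)) ->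
  LDP mu I -> LDP nu image_rate.
Proof.
move=> nuE [gI up low]; split; first exact: image_rate_good.
  move=> A clA; rewrite inf_image_rate.
  rewrite (_ : (fun n => _) =
      fun n => (n.+1%:R^-1)%R%:E * lne (mu n (f @^-1` A))); last first.
    by apply/funext => n; rewrite nuE//; right.
  apply: up; apply: closed_comp clA => x _; exact: cf.
move=> A oA; rewrite inf_image_rate.
rewrite (_ : (fun n => _) =
    fun n => (n.+1%:R^-1)%R%:E * lne (mu n (f @^-1` A))); last first.
  by apply/funext => n; rewrite nuE//; left.
apply: low; apply: open_comp oA => x _; exact: cf.
Qed.

End contraction.

(** * Images of laws under maps of linear growth *)

Section image_laws.
Context (R : realType) (p : R) (p1 : 1 <= p).

Lemma powRD_le (a b : R) : 0 <= a -> 0 <= b ->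
  (a + b) `^ p <= 2 `^ p * (a `^ p + b `^ p).
Proof.
move=> a0 b0; wlog ab : a b a0 b0 / a <= b => [H|].
  by have [|/ltW] := leP a b => [|ba]; [exact: H|rewrite addrC [X in _ * X]addrC H].
apply: (@le_trans _ _ ((2 * b) `^ p)).
  by apply: powR_le => //; lra.
by rewrite powRM// ler_wpM2l ?powR_ge0// lerDr powR_ge0.
Qed.

(** Linear growth keeps the moments of order [p] finite. Continuity rather than
    measurability, because it passes to [z |-> euler_path P z (f z)] without
    comparing product and Borel sigma-algebras. *)
Record lgmap (E F : normedModType R) := LGMap {
  lg_fun :> E -> F ;
  lg_continuous : continuous lg_fun ;
  lg_growth : exists2 C : R, 0 <= C & forall x, `|lg_fun x| <= C * (1 + `|x|) }.

Lemma lp_rv_of d (T : measurableType d) (Pr : probability T R)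
    (E : normedModType R) (f : T -> borel E) (P : wspace p E) :
  has_law Pr f P -> exists X : Lp_rv Pr p E, (X : T -> E) = f /\ law X = P.
Proof.
move=> fP; have [mf fPA] := fP.
pose X : {mfun T >-> borel E} := HB.pack f (isMeasurableFun.Build _ _ _ _ _ mf).
have mX : (moment p (distribution Pr X) < +oo)%E.
  apply: le_lt_trans (wspace_moment P); rewrite /moment.
  rewrite (@eq_measure_integral _ _ _ _ P)// => A mA _.
  by apply/esym; exact: fPA.
exists (LpRV mX); split => //; apply: (@has_law_unique _ _ _ _ _ Pr f) => //.
exact: (has_law_law (LpRV mX)).
Qed.

Lemma has_law_id (E : normedModType R) (P : wspace p E) : has_law P idfun P.
Proof. by split; first exact: measurable_id. Qed.

Section push.
Context (E F : normedModType R) (f : lgmap E F) (P : wspace p E).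

Definition lg_borel (x : borel E) : borel F := f x.

Lemma measurable_lg_borel : measurable_fun setT lg_borel.
Proof. by apply: continuous_borel; exact: lg_continuous. Qed.

HB.instance Definition _ :=
  isMeasurableFun.Build _ _ _ _ lg_borel measurable_lg_borel.

Lemma push_moment : (moment p (distribution P lg_borel) < +oo)%E.
Proof.
rewrite /moment ge0_integral_distribution; last 2 first.
- exact: measurable_norm_powR.
- by move=> x; rewrite lee_fin powR_ge0.
have [C C0 Cf] := lg_growth f; pose c := C `^ p * 2 `^ p.
have c0 : 0 <= c by rewrite mulr_ge0 ?powR_ge0.
apply: (@le_lt_trans _ _ (\int[P]_x (c%:E * (1 + (`|x : E| `^ p)%:E)))%E).
  apply: ge0_le_integral => //.
  - by move=> x _; rewrite lee_fin powR_ge0.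
  - by apply: measurableT_comp; [exact: measurable_norm_powR|exact: measurable_lg_borel].
  - apply: measurable_funeM; apply: emeasurable_funD => //.
    exact: measurable_norm_powR.
  move=> x _ /=; rewrite -EFinD -EFinM lee_fin.
  apply: (@le_trans _ _ ((C * (1 + `|x : E|)) `^ p)).
    by apply: powR_le => //; exact: Cf.
  rewrite powRM ?addr_ge0// -mulrA ler_wpM2l ?powR_ge0//.
  by apply: le_trans (powRD_le _ _) _ => //; rewrite powR1.
rewrite ge0_integralZl//; last 2 first.
- by apply: emeasurable_funD => //; exact: measurable_norm_powR.
- by move=> x _; rewrite adde_ge0// lee_fin powR_ge0.
apply: lte_mul_pinfty => //; rewrite ge0_integralD//; last first.
  exact: measurable_norm_powR.
apply: lte_add_pinfty; last exact: wspace_moment.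
by rewrite integral_cst// mul1e; apply: le_lt_trans (probability_le1 P _) _; rewrite ?ltry.
Qed.

Definition push : wspace p F := wspace_of push_moment.

Lemma has_law_push d (T : measurableType d) (Pr : probability T R)
    (Z : T -> borel E) :
  has_law Pr Z P -> has_law Pr (fun w => f (Z w) : borel F) push.
Proof.
move=> [mZ ZP]; split.
  exact: (measurableT_comp measurable_lg_borel mZ).
move=> A mA; rewrite wspace_ofE// /distribution /pushforward.
apply: etrans (ZP _ _) _ => //.
by rewrite -[_ @^-1` _]setTI; exact: measurable_lg_borel.
Qed.

End push.

End image_laws.

(** * Operations on paths *)

Section path_operations.
Context (R : realType) (T : {posnum R}).

Lemma norm_mulmx_le m n (A : 'M[R]_(m, n)) (v : 'cV[R]_n) :
  `|A *m v| <= n%:R * `|A| * `|v|.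
Proof.
rewrite [leLHS]mx_normrE; apply/bigmax_leP; split => [|[i j] _ /=].
  by rewrite !mulr_ge0.
rewrite mxE; apply: le_trans (ler_norm_sum _ _ _) _.
have -> : n%:R * `|A| * `|v| = \sum_(k < n) `|A| * `|v|.
  by rewrite sumr_const card_ord -[RHS]mulr_natl mulrA.
have entry (a c : nat) (B : 'M[R]_(a, c)) s t : `|B s t| <= `|B|.
  rewrite [leRHS]mx_normrE.
  exact: (@le_bigmax _ _ _ 0 (fun u => `|B u.1 u.2|) (s, t)).
by apply: ler_sum => k _; rewrite normrM ler_pM.
Qed.

Lemma mulmx_continuous m n (A : 'M[R]_(m, n)) :
  continuous (fun v : 'cV[R]_n => A *m v).
Proof.
move=> v; apply/(@cvgrPdist_lt _ _ _ (nbhs v)) => e e0; near=> w; rewrite -mulmxBr.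
apply: le_lt_trans (norm_mulmx_le _ _) _.
apply: (@le_lt_trans _ _ ((n%:R * `|A| + 1) * `|v - w|)).
  by rewrite ler_wpM2r// lerDl.
rewrite mulrC -ltr_pdivlMr ?ltr_wpDl ?mulr_ge0//.
near: w; apply/nbhs_ballP; exists (e / (n%:R * `|A| + 1)) => /=.
  by rewrite divr_gt0// ltr_wpDl ?mulr_ge0.
by move=> z; rewrite -ball_normE.
Unshelve. all: by end_near. Qed.

Lemma clamp_id (t : R) : t \in `[0, T%:num] -> clamp T%:num t = t.
Proof.
by rewrite in_itv /= /clamp => /andP[t0 tT]; rewrite (min_l tT) (max_r t0).
Qed.

Lemma clampK (t : R) : clamp T%:num (clamp T%:num t) = clamp T%:num t.
Proof. exact/clamp_id/clamp_itv. Qed.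

Lemma clamp_continuous : continuous (clamp T%:num).
Proof.
move=> t; rewrite /clamp.
apply: (@continuous_max _ _ (fun=> 0) (fun s : R => Num.min s T%:num)).
  exact: cvg_cst.
by apply: continuous_min; [exact: cvg_id|exact: cvg_cst].
Qed.

Lemma cst_path_subproof k (v : 'cV[R]_k) : (fun=> v) \in @is_cpath R T k.
Proof. by apply/asboolP; split => // t; exact: cvg_cst. Qed.

Definition cst_path k (v : 'cV[R]_k) := CPath (cst_path_subproof v).

Lemma ramp_subproof k (v : 'cV[R]_k) :
  (fun t => clamp T%:num t *: v) \in @is_cpath R T k.
Proof.
apply/asboolP; split => [t|t]; last by rewrite clampK.
by apply: cvgZr_tmp; exact: clamp_continuous.
Qed.

Definition ramp k (v : 'cV[R]_k) := CPath (ramp_subproof v).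

Lemma mul_path_subproof m n (A : 'M[R]_(m, n)) (w : cpath T n) :
  (fun t => A *m w t) \in @is_cpath R T m.
Proof.
apply/asboolP; split => [t|t]; last by rewrite -cpath_clamp.
apply: (@continuous_comp _ _ _ (fun t => w t) (mulmx A)).
  exact: cpath_continuous.
exact: mulmx_continuous.
Qed.

Definition mul_path m n (A : 'M[R]_(m, n)) (w : cpath T n) :=
  CPath (mul_path_subproof A w).

Lemma norm_cst_path k (v : 'cV[R]_k) : `|cst_path v| <= `|v|.
Proof. by rewrite cpath_normE; exact: sup_norm_le. Qed.

Lemma norm_ramp k (v : 'cV[R]_k) : `|ramp v| <= T%:num * `|v|.
Proof.
rewrite cpath_normE; apply: sup_norm_le => t /=; rewrite normrZ ler_wpM2r//.
by have := clamp_itv T t; rewrite in_itv /= => /andP[t0 tT]; rewrite ger0_norm.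
Qed.

Lemma norm_mul_path m n (A : 'M[R]_(m, n)) (w : cpath T n) :
  `|mul_path A w| <= n%:R * `|A| * `|w|.
Proof.
rewrite [leLHS]cpath_normE; apply: sup_norm_le => t /=.
apply: le_trans (norm_mulmx_le _ _) _; rewrite ler_wpM2l ?mulr_ge0//.
exact: le_sup_norm.
Qed.

Lemma cst_pathB k (u v : 'cV[R]_k) : cst_path u - cst_path v = cst_path (u - v).
Proof. exact: val_inj. Qed.

Lemma rampB k (u v : 'cV[R]_k) : ramp u - ramp v = ramp (u - v).
Proof. by apply: val_inj; apply/funext => t; rewrite /= scalerBr. Qed.

Lemma mul_pathB m n (A B : 'M[R]_(m, n)) (v w : cpath T n) :
  mul_path A v - mul_path B w = mul_path A (v - w) + mul_path (A - B) w.
Proof.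
apply: val_inj; apply/funext => t.
change (A *m v t - B *m w t = A *m (v t - w t) + (A - B) *m w t).
by rewrite mulmxBr mulmxBl addrA subrK.
Qed.

Lemma stopD k (t : R) (u v : cpath T k) : stop t (u + v) = stop t u + stop t v.
Proof. exact: val_inj. Qed.

Lemma stopB k (t : R) (u v : cpath T k) : stop t (u - v) = stop t u - stop t v.
Proof. exact: val_inj. Qed.

Lemma stop_sum k (t : R) n (u : 'I_n -> cpath T k) :
  stop t (\sum_(i < n) u i) = \sum_(i < n) stop t (u i).
Proof. by apply: (big_morph _ (stopD t)); exact: val_inj. Qed.

Lemma stop_stop k (s t : R) (u : cpath T k) :
  stop s (stop t u) = stop (Num.min s t) u.
Proof. by apply: val_inj; apply/funext => r /=; rewrite minA. Qed.

Lemma stop_id k (t : R) (u : cpath T k) : T%:num <= t -> stop t u = u.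
Proof.
move=> Tt; apply: val_inj; apply/funext => s /=.
rewrite cpath_clamp [RHS]cpath_clamp; congr (u _); rewrite /clamp -minA.
by rewrite (min_r Tt).
Qed.

Lemma cpath_eqP k (u v : cpath T k) :
  (forall t, t \in `[0, T%:num] -> u t = v t) -> u = v.
Proof.
move=> uv; apply: val_inj; apply/funext => t /=.
by rewrite cpath_clamp [RHS]cpath_clamp uv// clamp_itv.
Qed.

End path_operations.

(** * Stopped laws and the Euler scheme *)

Section stopped_laws.
Context (R : realType) (T : {posnum R}) (p : R) (p1 : 1 <= p) (k : nat).
Implicit Types P Q : wspace p (cpath T k).

Lemma has_law_stop d (Omega : measurableType d) (Pr : probability Omega R)
    (X : Omega -> borel (cpath T k)) P (t : R) :
  has_law Pr X P ->
  has_law Pr (fun w => stop t (X w) : borel (cpath T k)) (stop_law p1 t P).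
Proof.
move=> [mX XP]; split; first exact: (measurableT_comp (measurable_stop t) mX).
move=> A mA; rewrite wspace_ofE// /distribution /pushforward.
apply: etrans (XP _ _) _ => //.
by rewrite -[_ @^-1` _]setTI; exact: measurable_stop.
Qed.

(** Both sides are the law of the path stopped at [min s t]. *)
Lemma stop_law_stop_law (s t : R) P :
  stop_law p1 s (stop_law p1 t P) = stop_law p1 (Num.min s t) P.
Proof.
have Pid := has_law_id P.
have : has_law P (fun x => stop (Num.min s t) x : borel (cpath T k))
    (stop_law p1 s (stop_law p1 t P)).
  rewrite (_ : (fun x => _) = (fun x => stop s (stop t x))).
    exact: has_law_stop s (has_law_stop t Pid).
  by apply/funext => x; rewrite stop_stop.
by move/has_law_unique; apply; exact: has_law_stop Pid.
Qed.

Lemma wasserstein_stop_le d (Omega : measurableType d)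
    (Pr : probability Omega R) (X Y : Omega -> borel (cpath T k)) P Q (r t : R) :
  has_law Pr X P -> has_law Pr Y Q -> 0 <= r ->
  (lp_cost p Pr X Y <= (r `^ p)%:E)%E ->
  (wasserstein (stop_law p1 t P) (stop_law p1 t Q) <= r%:E)%E.
Proof.
move=> XP YQ r0 XYr.
have sepC := @separable_cpath R T k.
have XPt := has_law_stop t XP; have YQt := has_law_stop t YQ.
have [mX _] := XP; have [mY _] := YQ; have [mXt _] := XPt; have [mYt _] := YQt.
apply: (wasserstein_le p1 sepC XPt YQt r0).
refine (le_trans _ XYr).
apply: ge0_le_integral.
- exact: measurableT.
- by move=> w _; rewrite lee_fin powR_ge0.
- exact: (measurable_dist_powR sepC p mXt mYt).
- exact: (measurable_dist_powR sepC p mX mY).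
move=> w _; rewrite lee_fin; apply: powR_le => //.
by rewrite -stopB; exact: norm_stop.
Qed.

End stopped_laws.

Section euler_path.
Context (R : realType) (T : {posnum R}) (p : R) (p1 : 1 <= p) (d d' : nat).
Variable b : R -> cpath T d -> wspace p (cpath T d) -> 'cV[R]_d.
Variable sigma : R -> cpath T d -> wspace p (cpath T d) -> 'M[R]_(d, d').
Context (h : R) (h0 : 0 < h).
Local Notation input := ('cV[R]_d * cpath T d')%type.
Implicit Types (P : wspace p (cpath T d)) (z : input) (x : cpath T d).

(** All grid times [i * h] with [i < nb_steps] lie in [[0, T]], where the
    coefficients are constrained, and [T <= nb_steps * h]. *)
Definition nb_steps : nat := (Num.truncn (T%:num / h)).+1.

(** The primitive of the drift plus the noise driven by [w], both frozen at
    time [i * h]; the scheme only uses its increment over the i-th step. *)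
Definition frozen (i : nat) P (w : cpath T d') x : cpath T d :=
  ramp T (b (i%:R * h) x P) + mul_path (sigma (i%:R * h) x P) w.

Definition increment (i : nat) (u : cpath T d) : cpath T d :=
  stop (i.+1%:R * h) u - stop (i%:R * h) u.

(** Unlike the piecewise definition through [euler_map], this sum of increments of
    continuous paths is visibly a continuous path; a step that starts after [t]
    contributes nothing at time [t]. *)
Definition euler_path P z x : cpath T d :=
  cst_path T z.1 + \sum_(i < nb_steps) increment i (frozen i P z.2 x).

Lemma cpath_sumE n (u : 'I_n -> cpath T d) (t : R) :
  (\sum_(i < n) u i) t = \sum_(i < n) u i t.
Proof. by elim/big_ind2: _ => // u1 v1 u2 v2 <- <-. Qed.

Lemma grid_itv (i : nat) : (i < nb_steps)%N -> i%:R * h \in `[0, T%:num].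
Proof.
rewrite ltnS in_itv /= => iN; apply/andP; split; first by rewrite mulr_ge0// ltW.
rewrite -ler_pdivlMr//; apply: (@le_trans _ _ (Num.truncn (T%:num / h))%:R).
  by rewrite ler_nat.
by rewrite truncn_le divr_ge0 ?ltW.
Qed.

Lemma euler_pathE P z x (t : R) : t \in `[0, T%:num] ->
  euler_path P z x t = euler_map b sigma h P z.1 z.2 x t.
Proof.
move=> tT; rewrite /euler_map; set n := Num.truncn _.
have /andP[t0 tT'] : 0 <= t <= T%:num by rewrite in_itv in tT.
have /andP[nt tn] : n%:R * h <= t < n.+1%:R * h.
  by rewrite -ler_pdivlMr// -ltr_pdivrMr//; apply: truncn_itv; rewrite divr_ge0// ltW.
have nM : (n < nb_steps)%N.
  by rewrite ltnS /n le_truncn// ler_pM2r ?invr_gt0.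
have le_grid (i j : nat) : (i <= j)%N -> i%:R * h <= j%:R * h.
  by move=> ij; rewrite ler_wpM2r ?ler_nat ?ltW.
pose F i s := frozen i P z.2 x s.
have FB i (r s : R) : r \in `[0, T%:num] -> s \in `[0, T%:num] ->
    F i s - F i r =
    (s - r) *: b (i%:R * h) x P + sigma (i%:R * h) x P *m (z.2 s - z.2 r).
  move=> rT sT.
  rewrite [LHS]/((clamp _ s *: _ + _) - (clamp _ r *: _ + _)) !clamp_id//.
  by rewrite scalerBl mulmxBr opprD addrACA.
(* [G i] is the contribution of step [i] at time [t]; [n] is the current step. *)
pose G i := F i (Num.min t (i.+1%:R * h)) - F i (Num.min t (i%:R * h)).
transitivity (z.1 + \sum_(0 <= i < nb_steps) G i).
  rewrite big_mkord [LHS]/(z.1 + (\sum_(i < nb_steps) increment i (frozen i P z.2 x)) t).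
  by rewrite cpath_sumE.
have G_past i : (i < n)%N -> G i = h *: b (i%:R * h) x P +
    sigma (i%:R * h) x P *m (z.2 (i.+1%:R * h) - z.2 (i%:R * h)).
  move=> iN; rewrite /G.
  have hi1 : i.+1%:R * h <= t by apply: le_trans nt; exact: le_grid.
  have hi : i%:R * h <= t by apply: le_trans nt; apply: le_grid; exact: ltnW.
  rewrite (min_r hi1) (min_r hi) FB; last 2 first.
  - by apply: grid_itv; exact: ltn_trans iN nM.
  - by apply: grid_itv; exact: leq_ltn_trans iN nM.
  by congr (_ *: _ + _); rewrite -natr1 mulrDl mul1r addrAC subrr add0r.
have G_now : G n = (t - n%:R * h) *: b (n%:R * h) x P +
    sigma (n%:R * h) x P *m (z.2 t - z.2 (n%:R * h)).
  by rewrite /G (min_l (ltW tn)) (min_r nt) FB//; exact: grid_itv.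
have G_future i : (n < i)%N -> G i = 0.
  move=> ni; rewrite /G !min_l ?subrr//; apply: le_trans (ltW tn) _; apply: le_grid => //.
  exact: leqW.
rewrite (@big_cat_nat _ _ _ n) ?(ltnW nM)//= [X in _ + (_ + X)]big_ltn// G_now.
have -> : \sum_(n.+1 <= i < nb_steps) G i = 0.
  by rewrite big_nat big1// => i /andP[ni _]; exact: G_future.
rewrite addr0.
have -> : \sum_(0 <= i < n) G i = \sum_(0 <= i < n) (h *: b (i%:R * h) x P +
    sigma (i%:R * h) x P *m (z.2 (i.+1%:R * h) - z.2 (i%:R * h))).
  by apply: eq_big_nat => i /andP[_]; exact: G_past.
by rewrite -!addrA; congr (_ + _); rewrite [LHS]addrC -!addrA.
Qed.

Lemma euler_path_solves P z x :
  (forall t, t \in `[0, T%:num] -> x t = euler_map b sigma h P z.1 z.2 x t) <->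
  x = euler_path P z x.
Proof.
split => [xE|xE t tT]; last by rewrite -euler_pathE// -xE.
by apply: cpath_eqP => t tT; rewrite euler_pathE// xE.
Qed.

End euler_path.

(** * Coefficients *)

Section coefficients.
Context (R : realType) (T : {posnum R}) (p : R) (p1 : 1 <= p) (k : nat).
Context (V : normedModType R) (c : R -> cpath T k -> wspace p (cpath T k) -> V).
Hypothesis c_lip : coefficient_lipschitz p1 c.

Lemma coefficient_causal (t : R) x x' (P P' : wspace p (cpath T k)) :
  t \in `[0, T%:num] -> stop t x = stop t x' ->
  stop_law p1 t P = stop_law p1 t P' -> c t x P = c t x' P'.
Proof.
by have [L [_ [cbar [_ cE]]]] := c_lip => tT xx' PP'; rewrite !cE// xx' PP'.
Qed.

(** Stopping contracts the distance between paths, so the bound can be stated with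
    the paths themselves; the laws stay stopped, as [dl] is meant to come from
    [wasserstein_stop_le]. *)
Lemma coefficient_lip : exists2 L : R, 0 <= L &
  forall (t : R) x x' (P P' : wspace p (cpath T k)) (dl : R),
    t \in `[0, T%:num] ->
    (wasserstein (stop_law p1 t P) (stop_law p1 t P') <= dl%:E)%E ->
    `|c t x P - c t x' P'| <= L * (`|x - x'| + dl).
Proof.
have [L [L0 [cbar [cL cE]]]] := c_lip; exists L; first exact: ltW.
move=> t x x' P P' dl tT Wdl; rewrite !cE// -lee_fin.
apply: le_trans (cL _ _ _ _ _ _ tT tT) _; rewrite EFinM.
apply: lee_wpmul2l; first by rewrite lee_fin ltW.
rewrite [leRHS]EFinD; apply: leeD => //.
by rewrite lee_fin subrr normr0 add0r -stopB; exact: norm_stop.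
Qed.

End coefficients.

(** * Causality and stability of the scheme *)

Section euler_path_estimates.
Context (R : realType) (T : {posnum R}) (p : R) (p1 : 1 <= p) (d d' : nat).
Variable b : R -> cpath T d -> wspace p (cpath T d) -> 'cV[R]_d.
Variable sigma : R -> cpath T d -> wspace p (cpath T d) -> 'M[R]_(d, d').
Hypothesis b_lip : coefficient_lipschitz p1 b.
Hypothesis sigma_lip : coefficient_lipschitz p1 sigma.
Context (h : R) (h0 : 0 < h).
Local Notation input := ('cV[R]_d * cpath T d')%type.
Implicit Types (P : wspace p (cpath T d)) (z : input) (x : cpath T d).
Local Notation nb_steps := (nb_steps T h).
Local Notation euler_path := (euler_path b sigma h).
Local Notation frozen := (frozen b sigma h).

Lemma stop0_euler_path P z x :
  stop 0 (euler_path P z x) = stop 0 (cst_path T z.1).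
Proof.
rewrite /euler_path stopD stop_sum big1 ?addr0// => i _.
by rewrite stopB !stop_stop !min_l ?subrr// mulr_ge0// ltW.
Qed.

Lemma frozen_causal i P P' (w : cpath T d') x x' : (i < nb_steps)%N ->
  stop (i%:R * h) x = stop (i%:R * h) x' ->
  stop_law p1 (i%:R * h) P = stop_law p1 (i%:R * h) P' ->
  frozen i P w x = frozen i P' w x'.
Proof.
move=> iN xx' PP'; have iT := grid_itv h0 iN; rewrite /frozen.
by rewrite (coefficient_causal b_lip iT xx' PP')
           (coefficient_causal sigma_lip iT xx' PP').
Qed.

(** Up to time [(k + 1) * h] the scheme only reads its arguments up to time
    [k * h]. *)
Lemma euler_path_causal k P P' z x x' :
  stop (k%:R * h) x = stop (k%:R * h) x' ->
  stop_law p1 (k%:R * h) P = stop_law p1 (k%:R * h) P' ->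
  stop (k.+1%:R * h) (euler_path P z x) = stop (k.+1%:R * h) (euler_path P' z x').
Proof.
move=> xx' PP'; rewrite /euler_path !stopD !stop_sum; congr (_ + _).
apply: eq_bigr => i _; have [ik|ki] := leqP i k.
  have min_ik : Num.min (i%:R * h) (k%:R * h) = i%:R * h.
    by rewrite min_l// ler_wpM2r ?ler_nat// ltW.
  rewrite (@frozen_causal i P P' z.2 x x')//.
    by rewrite -min_ik -!stop_stop xx'.
  by rewrite -min_ik -!stop_law_stop_law PP'.
have le_ki : k.+1%:R * h <= i%:R * h by rewrite ler_wpM2r ?ler_nat// ltW.
have le_ki1 : k.+1%:R * h <= i.+1%:R * h.
  by apply: le_trans le_ki _; rewrite ler_wpM2r ?ler_nat// ltW.
by rewrite !stopB !stop_stop !min_l// !subrr.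
Qed.

Hypothesis sigma_bounded : coefficient_bounded sigma.

Lemma norm_increment (i : nat) (u v : cpath T d) :
  `|increment h i u - increment h i v| <= 2 * `|u - v|.
Proof.
rewrite /increment opprD addrACA -opprD -!stopB.
apply: le_trans (ler_normB _ _) _; rewrite [leRHS]mulr_natl mulr2n.
by apply: lerD; exact: norm_stop.
Qed.

(** The term in [Num.min] comes from the change of sigma, which is bounded as well
    as Lipschitz, multiplied by the noise [z'.2] of the second input. *)
Lemma frozen_dist : exists2 C : R, 0 <= C &
  forall i P P' z z' x x' (dl : R), (i < nb_steps)%N -> 0 <= dl ->
    (forall t, (wasserstein (stop_law p1 t P) (stop_law p1 t P') <= dl%:E)%E) ->
    `|frozen i P z.2 x - frozen i P' z'.2 x'| <=
      C * (`|z - z'| + (`|x - x'| + dl) +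
           Num.min 1 (`|x - x'| + dl) * `|z'|).
Proof.
have [Lb Lb0 bL] := coefficient_lip b_lip.
have [Ls Ls0 sL] := coefficient_lip sigma_lip.
have [Ms [Ms0 sM]] := sigma_bounded.
have n0 : 0 <= d'%:R :> R by [].
exists (T%:num * Lb + d'%:R * Ms + d'%:R * (2 * Ms + Ls)).
  by rewrite !addr_ge0 ?mulr_ge0 ?addr_ge0 ?mulr_ge0// ltW.
move=> i P P' z z' x x' dl iN dl0 Wdl; have iT := grid_itv h0 iN.
have Db := bL _ x x' P P' _ iT (Wdl _).
have Ds := sL _ x x' P P' _ iT (Wdl _).
set D := `|x - x'| + dl in Db Ds *.
have D0 : 0 <= D by rewrite addr_ge0.
have w1 : `|z.2 - z'.2| <= `|z - z'| by rewrite [leRHS]/(Num.max _ _) le_max lexx orbT.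
have w2 : `|z'.2| <= `|z'| by rewrite [leRHS]/(Num.max _ _) le_max lexx orbT.
have Ds' : `|sigma (i%:R * h) x P - sigma (i%:R * h) x' P'| <=
    (2 * Ms + Ls) * Num.min 1 D.
  have [D1|D1] := leP D 1.
    apply: le_trans Ds _; rewrite ler_wpM2r//.
    by rewrite lerDr mulr_ge0// ltW.
  rewrite mulr1; apply: le_trans (ler_normB _ _) _.
  have -> : 2 * Ms = Ms + Ms by rewrite mulr_natl mulr2n.
  rewrite -[leLHS]addr0; apply: lerD => //.
  by apply: lerD; exact: sM.
have m0 : 0 <= Num.min 1 D by rewrite le_min ler01.
apply: (@le_trans _ _ (T%:num * Lb * D + d'%:R * Ms * `|z - z'| +
    d'%:R * ((2 * Ms + Ls) * Num.min 1 D) * `|z'|)).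
  rewrite /frozen opprD addrACA rampB mul_pathB addrA.
  apply: le_trans (ler_normD _ _) _; apply: lerD.
    apply: le_trans (ler_normD _ _) _; apply: lerD.
      apply: le_trans (norm_ramp _ _) _.
      by rewrite -mulrA ler_wpM2l.
    apply: le_trans (norm_mul_path _ _) _.
    by apply: ler_pM => //; rewrite ?mulr_ge0// ler_wpM2l// sM.
  apply: le_trans (norm_mul_path _ _) _.
  by apply: ler_pM => //; rewrite ?mulr_ge0// ler_wpM2l.
have : 0 <= T%:num * Lb by rewrite mulr_ge0.
have : 0 <= d'%:R * Ms by rewrite mulr_ge0// ltW.
have : 0 <= d'%:R * (2 * Ms + Ls) by rewrite mulr_ge0 ?addr_ge0 ?mulr_ge0// ltW.
have : 0 <= Num.min 1 D * `|z'| by rewrite mulr_ge0.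
have : 0 <= `|z - z'| by [].
have -> : d'%:R * ((2 * Ms + Ls) * Num.min 1 D) * `|z'| =
  d'%:R * (2 * Ms + Ls) * (Num.min 1 D * `|z'|) by rewrite !mulrA.
move: (T%:num * Lb) (d'%:R * Ms) (d'%:R * (2 * Ms + Ls)) (`|z - z'|) (Num.min 1 D * _).
clear -D0 => A B C u v u0 v0 C0 B0 A0; nra.
Qed.

Lemma euler_path_dist : exists2 C : R, 0 <= C &
  forall P P' z z' x x' (dl : R), 0 <= dl ->
    (forall t, (wasserstein (stop_law p1 t P) (stop_law p1 t P') <= dl%:E)%E) ->
    `|euler_path P z x - euler_path P' z' x'| <=
      C * (`|z - z'| + (`|x - x'| + dl) +
           Num.min 1 (`|x - x'| + dl) * `|z'|).
Proof.
have [C C0 frozenC] := frozen_dist.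
exists (1 + nb_steps%:R * (2 * C)); first by rewrite addr_ge0 ?mulr_ge0.
move=> P P' z z' x x' dl dl0 Wdl.
have {}frozenC i (iN : (i < nb_steps)%N) := frozenC i P P' z z' x x' dl iN dl0 Wdl.
set B := `|z - z'| + (`|x - x'| + dl) + Num.min 1 (`|x - x'| + dl) * `|z'|
  in frozenC *.
have zB : `|z - z'| <= B.
  by rewrite /B -addrA lerDl !addr_ge0// mulr_ge0// le_min ler01 addr_ge0.
rewrite /euler_path opprD addrACA cst_pathB -sumrB mulrDl mul1r.
apply: le_trans (ler_normD _ _) _; apply: lerD.
  apply: le_trans (norm_cst_path _ _) _; apply: le_trans zB.
  by rewrite [leRHS]/(Num.max _ _) le_max lexx.
apply: le_trans (ler_norm_sum _ _ _) _.
have -> : nb_steps%:R * (2 * C) * B = \sum_(i < nb_steps) 2 * C * B.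
  by rewrite sumr_const card_ord -[RHS]mulr_natl !mulrA.
apply: ler_sum => i _; apply: le_trans (norm_increment _ _ _) _.
by rewrite -mulrA ler_wpM2l// frozenC.
Qed.

End euler_path_estimates.

(** * Picard iteration of the Euler scheme *)

Section picard.
Context (R : realType) (T : {posnum R}) (p : R) (p1 : 1 <= p) (d d' : nat).
Variable b : R -> cpath T d -> wspace p (cpath T d) -> 'cV[R]_d.
Variable sigma : R -> cpath T d -> wspace p (cpath T d) -> 'M[R]_(d, d').
Hypothesis b_lip : coefficient_lipschitz p1 b.
Hypothesis sigma_lip : coefficient_lipschitz p1 sigma.
Hypothesis sigma_bounded : coefficient_bounded sigma.
Context (h : R) (h0 : 0 < h).
Local Notation E := ('cV[R]_d * cpath T d')%type.
Local Notation F := (cpath T d).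
Implicit Types (P : wspace p F) (Q : wspace p E) (z : E) (x : F).
Local Notation nb_steps := (nb_steps T h).
Local Notation euler_path := (euler_path b sigma h).

Lemma lp_cost_refl disp (Omega : measurableType disp)
    (Pr : probability Omega R) (G : normedModType R) (X : Omega -> borel G) :
  lp_cost p Pr X X = 0%E.
Proof.
rewrite /lp_cost; under eq_integral do rewrite subrr normr0.
by rewrite powR0 ?integral0// gt_eqF// (lt_le_trans ltr01).
Qed.

Lemma wasserstein_stop_refl P (t : R) :
  (wasserstein (stop_law p1 t P) (stop_law p1 t P) <= 0%:E)%E.
Proof.
have Pid := has_law_id P.
apply: (wasserstein_stop_le p1 _ Pid Pid (lexx 0)).
by rewrite lp_cost_refl lee_fin powR_ge0.
Qed.

Lemma cst_path_continuous : continuous (fun z : E => cst_path T z.1).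
Proof.
move=> z; apply/(@cvgrPdist_lt _ _ _ (nbhs z)) => e e0; near=> y.
rewrite cst_pathB; apply: le_lt_trans (norm_cst_path _ _) _.
apply: (@le_lt_trans _ _ `|z - y|).
  by rewrite [leRHS]/(Num.max _ _) le_max lexx.
near: y; apply/nbhs_ballP; exists e => //= y.
by rewrite -ball_normE.
Unshelve. all: by end_near. Qed.

Lemma cst_path_growth : exists2 C : R, 0 <= C &
  forall z : E, `|cst_path T z.1| <= C * (1 + `|z|).
Proof.
exists 1 => // z; rewrite mul1r; apply: le_trans (norm_cst_path _ _) _.
apply: (@le_trans _ _ `|z|); last by rewrite lerDr.
by rewrite [leRHS]/(Num.max _ _) le_max lexx.
Qed.

Definition cst_lg : lgmap E F := LGMap cst_path_continuous cst_path_growth.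

Section step.
Variables (P : wspace p F) (f : lgmap E F).

Let step (z : E) : F := euler_path P z (f z).

Lemma step_continuous : continuous step.
Proof.
have [C C0 Cdist] := euler_path_dist b_lip sigma_lip h0 sigma_bounded.
move=> z; apply/(@cvgrPdist_lt _ _ _ (nbhs z)) => e e0.
(* With [u], [v] the distances of the inputs and of their images by [f], the
   bound of [euler_path_dist] is at most [C * (u + v + v * |z|)]. *)
pose K := C * (2 + `|z|) + 1.
have K0 : 0 < K by rewrite ltr_wpDl// mulr_ge0// addr_ge0.
have eK : 0 < e / K by rewrite divr_gt0.
near=> y; rewrite distrC.
have zy : `|y - z| < e / K.
  by near: y; apply/nbhs_ballP; exists (e / K) => //= y; rewrite -ball_normE /= distrC.
have fzy : `|f y - f z| < e / K.
  rewrite distrC; near: y.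
  exact: ((@cvgrPdist_lt _ _ _ (nbhs z) _ _ _).1 (@lg_continuous _ _ _ f z)).
apply: le_lt_trans (Cdist P P y z (f y) (f z) 0 (lexx _) (wasserstein_stop_refl P)) _.
rewrite addr0; set u := `|y - z| in zy *; set v := `|f y - f z| in fzy *.
apply: (@le_lt_trans _ _ (C * (2 + `|z|) * (e / K))).
  rewrite -mulrA ler_wpM2l//.
  have -> : (2 + `|z|) * (e / K) = e / K + e / K + e / K * `|z| by ring.
  apply: lerD; first by apply: lerD; exact: ltW.
  by rewrite ler_wpM2r// ge_min (ltW fzy) orbT.
have -> : C * (2 + `|z|) = K - 1 by rewrite addrK.
rewrite mulrBl mul1r mulrCA divff ?gt_eqF// mulr1.
by rewrite ltrBlDr ltrDl.
Unshelve. all: by end_near. Qed.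

(** [euler_path_dist] against the zero input has no [Num.min] term. *)
Lemma step_growth : exists2 C : R, 0 <= C &
  forall z : E, `|step z| <= C * (1 + `|z|).
Proof.
have [C C0 Cdist] := euler_path_dist b_lip sigma_lip h0 sigma_bounded.
have [C' C'0 Cf] := lg_growth f; pose a := `|euler_path P 0 0|.
have a0 : 0 <= a by exact: normr_ge0.
exists (a + C * (1 + C')); first by rewrite addr_ge0// mulr_ge0// addr_ge0.
move=> z.
have Cz := Cdist P P z 0 (f z) 0 0 (lexx _) (wasserstein_stop_refl P).
rewrite !subr0 normr0 mulr0 !addr0 in Cz.
apply: (@le_trans _ _ (a + C * (`|z| + `|f z|))).
  by rewrite -lerBlDl; apply: le_trans Cz; exact: lerB_dist.
have := Cf z; have := normr_ge0 (f z); have : 0 <= `|z| by [].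
move: (`|z|) (`|f z|) => u v u0 v0 vC.
have : C * v <= C * (C' * (1 + u)) by rewrite ler_wpM2l.
have : 0 <= C * C' by rewrite mulr_ge0.
have : 0 <= a * u by rewrite mulr_ge0.
lra.
Qed.

Definition step_lg : lgmap E F := LGMap step_continuous step_growth.

End step.

(** The law that enters the interaction is updated together with the path: at each
    step it is the law of the previous iterate. *)
Fixpoint picard (k : nat) Q : lgmap E F :=
  if k is j.+1 then step_lg (push p1 (picard j Q) Q) (picard j Q) else cst_lg.

Definition picard_law (k : nat) Q : wspace p F := push p1 (picard k Q) Q.

Lemma picardS k Q z :
  picard k.+1 Q z = euler_path (picard_law k Q) z (picard k Q z).
Proof. by []. Qed.

Lemma stop_law_eq_ae disp (Omega : measurableType disp)
    (Pr : probability Omega R) (X Y : Omega -> borel F) P P' (t : R) :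
  has_law Pr X P -> has_law Pr Y P' ->
  {ae Pr, forall w, stop t (X w) = stop t (Y w)} ->
  stop_law p1 t P = stop_law p1 t P'.
Proof.
by move=> XP YP XY; apply: has_law_ae (has_law_stop p1 t XP) (has_law_stop p1 t YP) XY.
Qed.

Lemma le_T_nb_steps : T%:num <= nb_steps%:R * h.
Proof.
rewrite -ler_pdivrMr// ltW//.
have : 0 <= T%:num / h by rewrite divr_ge0// ltW.
by move=> /truncn_itv/andP[].
Qed.

(** The step of the induction: if [X] and the k-th iterate agree up to [k * h], so
    do their laws, and causality gives one more step. *)
Lemma solution_picard disp (Omega : measurableType disp)
    (Pr : probability Omega R) (Z : Omega -> borel E) (X : Omega -> borel F)
    Q P k :
  has_law Pr Z Q -> has_law Pr X P ->
  {ae Pr, forall w, (X w : F) = euler_path P (Z w) (X w)} ->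
  {ae Pr, forall w, stop (k%:R * h) (X w) = stop (k%:R * h) (picard k Q (Z w))}.
Proof.
move=> ZQ XP XE; elim: k => [|k IH].
  apply: filterS XE => w XE; rewrite mul0r {1}XE.
  by rewrite (stop0_euler_path _ _ h0).
have PP := stop_law_eq_ae XP (has_law_push p1 (picard k Q) ZQ) IH.
apply: filterS2 XE IH => w XwE IHw; rewrite {1}XwE picardS.
exact: (euler_path_causal b_lip sigma_lip h0 _ IHw PP).
Qed.

Lemma solution_law disp (Omega : measurableType disp)
    (Pr : probability Omega R) (Z : Omega -> borel E) (X : Omega -> borel F)
    Q P :
  has_law Pr Z Q -> has_law Pr X P ->
  {ae Pr, forall w, (X w : F) = euler_path P (Z w) (X w)} ->
  P = picard_law nb_steps Q.
Proof.
move=> ZQ XP XE.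
apply: (has_law_ae XP (has_law_push p1 (picard nb_steps Q) ZQ)).
apply: filterS (solution_picard nb_steps ZQ XP XE) => w.
by rewrite !stop_id// le_T_nb_steps.
Qed.

Lemma stop_picard k Q z :
  stop (k%:R * h) (picard k Q z) = stop (k%:R * h) (picard k.+1 Q z).
Proof.
elim: k z => [|k IH] z.
  by rewrite mul0r picardS (stop0_euler_path _ _ h0).
have Qid := has_law_id Q.
have QQ : stop_law p1 (k%:R * h) (picard_law k Q) =
          stop_law p1 (k%:R * h) (picard_law k.+1 Q).
  apply: stop_law_eq_ae (has_law_push p1 _ Qid) (has_law_push p1 _ Qid) _.
  exact: aeW.
rewrite picardS [in RHS]picardS.
exact: (euler_path_causal b_lip sigma_lip h0 _ (IH z) QQ).
Qed.

(** The iterates are stationary on [[0, nb_steps * h]], which contains [[0, T]]. *)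
Lemma picard_fixpoint Q z :
  picard nb_steps Q z =
  euler_path (picard_law nb_steps Q) z (picard nb_steps Q z).
Proof.
have := stop_picard nb_steps Q z.
by rewrite !stop_id// le_T_nb_steps.
Qed.

Lemma mkv_solution_law disp (Omega : measurableType disp)
    (Pr : probability Omega R) (Z : Lp_rv Pr p E) (X : Lp_rv Pr p F) :
  mkv_solution b sigma h Z X -> law X = picard_law nb_steps (law Z).
Proof.
move=> solX; apply: (solution_law (has_law_law Z) (has_law_law X)).
by apply: filterS solX => w /(euler_path_solves _ _ h0).
Qed.

(** For existence, the identity on the space [E] with the law [Q] is an input with
    law [Q], and the last Picard iterate solves the equation for it. *)
Lemma PsiE Q : Psi b sigma h Q = picard_law nb_steps Q.
Proof.
rewrite /Psi; apply: xget_subset1; last first.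
  move=> P P' [? [? [? [Z [X [ZQ /mkv_solution_law XE <-]]]]]].
  by move=> [? [? [? [Z' [X' [ZQ' /mkv_solution_law XE' <-]]]]]]; rewrite XE XE' ZQ ZQ'.
have Qid := has_law_id Q.
have [Z [ZE lawZ]] := lp_rv_of Qid.
have [X [XE lawX]] := lp_rv_of (has_law_push p1 (picard nb_steps Q) Qid).
exists (sigma_display (@open E)), (borel E), Q, Z, X; split => //.
apply: aeW => z; apply/(euler_path_solves _ _ h0).
have -> : (X z : F) = picard nb_steps Q z by rewrite XE.
have -> : Z z = z by rewrite ZE.
by rewrite lawX; exact: picard_fixpoint.
Qed.

End picard.

(** * Continuity of the law of the scheme *)

Section tails.
Context (R : realType) (p : R) (E : normedModType R).

Definition tail_powR (rho : R) (x : E) : R :=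
  if rho < `|x| then `|x| `^ p else 0.

Lemma tail_powR_ge0 rho x : 0 <= tail_powR rho x.
Proof. by rewrite /tail_powR; case: ifP; rewrite // powR_ge0. Qed.

Lemma measurable_tail_powR rho :
  measurable_fun setT (fun x : borel E => (tail_powR rho x)%:E).
Proof.
apply/measurable_EFinP; apply: measurable_fun_ifT => //.
  apply: measurable_fun_ltr => //.
  by apply: continuous_borel_real => x; exact: norm_continuous.
by apply/measurable_EFinP; exact: measurable_norm_powR.
Qed.

(** Dominated convergence, with the finite moment as domination. *)
Lemma tail_powR_small (Q : wspace p E) (e : R) : 0 < e ->
  exists2 rho : R, 0 <= rho & (\int[Q]_x (tail_powR rho x)%:E < e%:E)%E.
Proof.
move=> e0.
have : (\int[Q]_x (tail_powR n%:R x)%:E @[n --> \oo] --> \int[Q]_x (0 : \bar R))%E.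
  apply: (@dominated_cvg _ _ _ Q setT measurableT
    (fun n (x : borel E) => (tail_powR n%:R x)%:E) (fun=> 0%E)
    (fun x : borel E => (`|x : E| `^ p)%:E)).
  - by move=> n; exact: measurable_tail_powR.
  - move=> x _; apply: cvg_near_cst; near=> n.
    rewrite /tail_powR ltNge (_ : `|x : E| <= n%:R)//.
    by near: n; exact: nbhs_infty_ger.
  - by [].
  - apply/integrableP; split; first exact: measurable_norm_powR.
    apply: le_lt_trans (wspace_moment Q); rewrite le_eqVlt; apply/orP; left.
    by apply/eqP; apply: eq_integral => x _; rewrite gee0_abs// lee_fin powR_ge0.
  - move=> n x _; rewrite gee0_abs ?lee_fin ?tail_powR_ge0// /tail_powR.
    by case: ifP => // _; exact: powR_ge0.
rewrite integral0 => /fine_cvgP[fin]; move/(@cvgrPdist_lt _ _ _ _ _ _ 0)/(_ _ e0) => lim.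
near \oo => n; exists n%:R => //.
have nfin : (\int[Q]_x (tail_powR n%:R x)%:E)%E \is a fin_num by near: n.
rewrite -(fineK nfin) lte_fin; near: n.
apply: filterS lim => n /=; rewrite sub0r normrN; apply: le_lt_trans; exact: ler_norm.
Unshelve. all: by end_near. Qed.

End tails.

Section powR_bound.
Context (R : realType) (p : R) (p1 : 1 <= p).

(** [C * (...)] is the bound of [euler_path_dist], with [a], [v], [c] standing for
    the norms of [z - z'], [x - x'] and [z'], and [r] for the distance of laws.
    The factor [1 + rho ^ p] comes from splitting according to [c <= rho]. *)
Lemma powR_step_bound (C a v r c rho : R) : 0 <= C -> 0 <= a -> 0 <= v ->
  0 <= r -> 0 <= c -> 0 <= rho ->
  (C * (a + (v + r) + Num.min 1 (v + r) * c)) `^ p <=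
  C `^ p * (2 `^ p) * a `^ p +
  C `^ p * (2 `^ p) ^+ 3 * (1 + rho `^ p) * (v `^ p + r `^ p) +
  C `^ p * (2 `^ p) ^+ 2 * (if rho < c then c `^ p else 0).
Proof.
move=> C0 a0 v0 r0 c0 rho0; set D := v + r; set m := Num.min 1 D.
have D0 : 0 <= D by rewrite addr_ge0.
have m0 : 0 <= m by rewrite le_min ler01.
have k0 : 0 <= 2 `^ p :> R by exact: powR_ge0.
have h1 := powRD_le p1 a0 (addr_ge0 D0 (mulr_ge0 m0 c0)).
have h2 := powRD_le p1 D0 (mulr_ge0 m0 c0).
have h3 := powRD_le p1 v0 r0.
set tl := (if _ then _ else _).
have tl0 : 0 <= tl by rewrite /tl; case: ifP => // _; exact: powR_ge0.
have h4 : (m * c) `^ p <= rho `^ p * D `^ p + tl.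
  rewrite /tl; case: ltP => [rc|cr].
    apply: (@le_trans _ _ (c `^ p)); last by rewrite lerDr mulr_ge0 ?powR_ge0.
    by apply: powR_le; rewrite ?mulr_ge0// ler_piMl// ge_min lexx.
  rewrite addr0 -powRM// mulrC; apply: powR_le; rewrite ?mulr_ge0//.
  by rewrite ler_pM// ge_min lexx orbT.
rewrite powRM ?addr_ge0 ?mulr_ge0// -addrA.
set k := 2 `^ p in k0 h1 h2 h3 *.
apply: (@le_trans _ _ (C `^ p * (k * a `^ p + k * (k * ((1 + rho `^ p) *
   (k * (v `^ p + r `^ p)) + tl))))); last by rewrite le_eqVlt; apply/orP; left; apply/eqP; ring.
rewrite ler_wpM2l ?powR_ge0//; apply: le_trans h1 _; rewrite mulrDr lerD2l.
rewrite ler_wpM2l//; apply: le_trans h2 _; rewrite ler_wpM2l//.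
apply: (@le_trans _ _ ((1 + rho `^ p) * D `^ p + tl)).
  by rewrite mulrDl mul1r -addrA lerD2l.
by rewrite lerD2r ler_wpM2l// addr_ge0// powR_ge0.
Qed.

End powR_bound.

Section stability.
Context (R : realType) (T : {posnum R}) (p : R) (p1 : 1 <= p) (d d' : nat).
Variable b : R -> cpath T d -> wspace p (cpath T d) -> 'cV[R]_d.
Variable sigma : R -> cpath T d -> wspace p (cpath T d) -> 'M[R]_(d, d').
Hypothesis b_lip : coefficient_lipschitz p1 b.
Hypothesis sigma_lip : coefficient_lipschitz p1 sigma.
Hypothesis sigma_bounded : coefficient_bounded sigma.
Context (h : R) (h0 : 0 < h).
Local Notation E := ('cV[R]_d * cpath T d')%type.
Local Notation F := (cpath T d).
Local Notation picard := (picard b_lip sigma_lip sigma_bounded h0).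
Local Notation picard_law := (picard_law b_lip sigma_lip sigma_bounded h0).
Local Notation euler_path := (euler_path b sigma h).

Let sepE : separable E.
Proof. by apply: separable_prod; [exact: separable_cV|exact: separable_cpath]. Qed.

Let sepF : separable F. Proof. exact: separable_cpath. Qed.

Let ge0_cost disp (Omega : measurableType disp) (G : normedModType R)
  (f g : Omega -> borel G) w : (0 <= (`|(f w : G) - g w| `^ p)%:E)%E.
Proof. by rewrite lee_fin powR_ge0. Qed.

Lemma integral_step_le disp (Omega : measurableType disp)
    (Pr : probability Omega R) (Z Z' : Omega -> borel E)
    (X X' Y Y' : Omega -> borel F) (A1 A2 A3 i rho : R) :
  measurable_fun setT Z -> measurable_fun setT Z' ->
  measurable_fun setT X -> measurable_fun setT X' ->
  measurable_fun setT Y -> measurable_fun setT Y' ->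
  0 <= A1 -> 0 <= A2 -> 0 <= A3 -> 0 <= i ->
  (forall w, `|(Y w : F) - Y' w| `^ p <= A1 * `|(Z w : E) - Z' w| `^ p +
     A2 * (`|(X w : F) - X' w| `^ p + i) + A3 * tail_powR p rho (Z' w : E)) ->
  (lp_cost p Pr Y Y' <= A1%:E * lp_cost p Pr Z Z' +
     A2%:E * (lp_cost p Pr X X' + i%:E) +
     A3%:E * \int[Pr]_w (tail_powR p rho (Z' w : E))%:E)%E.
Proof.
move=> mZ mZ' mX mX' mY mY' A10 A20 A30 i0 YY'.
have mZZ := measurable_dist_powR sepE p mZ mZ'.
have mXX := measurable_dist_powR sepF p mX mX'.
have mYY := measurable_dist_powR sepF p mY mY'.
have mt := measurableT_comp (measurable_tail_powR p (E := E) rho) mZ'.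
have t0 w : (0 <= (tail_powR p rho (Z' w : E))%:E)%E by rewrite lee_fin tail_powR_ge0.
have ie0 : (0 <= i%:E)%E by rewrite lee_fin.
have A1e : (0 <= A1%:E)%E by rewrite lee_fin.
have A2e : (0 <= A2%:E)%E by rewrite lee_fin.
have A3e : (0 <= A3%:E)%E by rewrite lee_fin.
have -> : i%:E = (\int[Pr]_w (i%:E))%E.
  by rewrite integral_cst//= probability_setT mule1.
rewrite /lp_cost.
have mXXi : measurable_fun setT (fun w => (`|(X w : F) - X' w| `^ p)%:E + i%:E)%E.
  exact (emeasurable_funD mXX (measurable_cst _)).
have XXi0 w : (0 <= (`|(X w : F) - X' w| `^ p)%:E + i%:E)%E.
  exact (adde_ge0 (ge0_cost X X' w) ie0).
rewrite -(ge0_integralD Pr measurableT (fun w _ => ge0_cost X X' w) mXX (fun _ _ => ie0) (measurable_cst _)).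
rewrite -(ge0_integralZl Pr measurableT mXXi (fun w _ => XXi0 w) A2e).
rewrite -(ge0_integralZl Pr measurableT mZZ (fun w _ => ge0_cost Z Z' w) A1e).
rewrite -(ge0_integralZl Pr measurableT mt (fun w _ => t0 w) A3e).
have m1 := measurable_funeM A1%:E mZZ.
have m2 := measurable_funeM A2%:E mXXi.
have m3 := measurable_funeM A3%:E mt.
rewrite -(ge0_integralD Pr measurableT (fun w _ => mule_ge0 A1e (ge0_cost Z Z' w)) m1
   (fun w _ => mule_ge0 A2e (XXi0 w)) m2).
rewrite -(ge0_integralD Pr measurableT (fun w _ => adde_ge0 (mule_ge0 A1e (ge0_cost Z Z' w))
    (mule_ge0 A2e (XXi0 w))) (emeasurable_funD m1 m2)
   (fun w _ => mule_ge0 A3e (t0 w)) m3).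
apply: (ge0_le_integral Pr measurableT (fun w _ => ge0_cost Y Y' w) mYY
   (emeasurable_funD (emeasurable_funD m1 m2) m3)).
move=> w _; exact: YY'.
Qed.

Lemma measurable_lgmap disp (Omega : measurableType disp) (G G' : normedModType R)
    (f : lgmap G G') (Z : Omega -> borel G) :
  measurable_fun setT Z -> measurable_fun setT (fun w => f (Z w) : borel G').
Proof. by move=> mZ; exact: (measurableT_comp (measurable_lg_borel f) mZ). Qed.

Let mul_div_le (A e : R) : 0 <= A -> 0 <= e -> A * (e / (A + 1)) <= e.
Proof.
move=> A0 e0; rewrite mulrCA ler_piMr// ler_pdivrMr ?ltr_wpDl// mul1r.
by rewrite lerDl.
Qed.

Let three_quarters_lt (e : R) : 0 < e -> e / 4 + e / 4 + e / 4 < e.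
Proof. by move=> e0; lra. Qed.

(** The constants are chosen in this order: [rho] for the tail under [Q], then
    [eta] for the previous iterates, whose coefficient depends on [rho], and
    then the bound on the inputs. Each of the three contributions is at most
    [e / 4]. *)
Lemma picard_stable k (Q : wspace p E) (e : R) : 0 < e ->
  exists2 dl : R, 0 < dl & forall disp (Omega : measurableType disp)
    (Pr : probability Omega R) (Z Z' : Omega -> borel E) (Q' : wspace p E),
    has_law Pr Z Q' -> has_law Pr Z' Q -> (lp_cost p Pr Z Z' < dl%:E)%E ->
    (lp_cost p Pr (fun w => picard k Q' (Z w) : borel F)
                  (fun w => picard k Q (Z' w) : borel F) < e%:E)%E.
Proof.
elim: k e => [|k IH] e e0.
  exists e; first exact: e0.
  move=> disp Omega Pr Z Z' Q' [mZ _] [mZ' _]; apply: le_lt_trans.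
  have mY := measurable_lgmap (picard 0 Q') mZ.
  have mY' := measurable_lgmap (picard 0 Q) mZ'.
  apply: (ge0_le_integral Pr measurableT (fun w _ => ge0_cost _ _ w)
    (measurable_dist_powR sepF p mY mY') (measurable_dist_powR sepE p mZ mZ')).
  move=> w _; rewrite lee_fin; apply: powR_le => //=.
  rewrite cst_pathB; apply: le_trans (norm_cst_path _ _) _.
  by rewrite [leRHS]/(Num.max _ _) le_max lexx.
have [C C0 Cdist] := euler_path_dist b_lip sigma_lip h0 sigma_bounded.
have e4 : 0 < e / 4 by rewrite divr_gt0.
pose A3 := C `^ p * (2 `^ p) ^+ 2.
have A30 : 0 <= A3 by rewrite mulr_ge0 ?exprn_ge0 ?powR_ge0.
have w0 : 0 < e / 4 / (A3 + 1) by rewrite divr_gt0// ltr_wpDl.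
have [rho rho0 tail] := tail_powR_small Q w0.
pose A1 := C `^ p * (2 `^ p).
have A10 : 0 <= A1 by rewrite mulr_ge0 ?powR_ge0.
have u0 : 0 < e / 4 / (A1 + 1) by rewrite divr_gt0// ltr_wpDl.
pose A2 := C `^ p * (2 `^ p) ^+ 3 * (1 + rho `^ p).
have A20 : 0 <= A2.
  by apply: mulr_ge0; [rewrite mulr_ge0 ?exprn_ge0 ?powR_ge0|rewrite addr_ge0 ?powR_ge0].
(* The last division by 2: the cost of the previous iterates enters twice, once
   as such and once as the distance between their laws. *)
pose eta := e / 4 / (A2 + 1) / 2.
have eta0 : 0 < eta by rewrite !divr_gt0// ltr_wpDl.
have [dl dl0 Hdl] := IH eta eta0.
exists (Num.min dl (e / 4 / (A1 + 1))); first by rewrite lt_min dl0.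
move=> disp Omega Pr Z Z' Q' ZQ' Z'Q; rewrite EFin_min lt_min => /andP[Zdl Zu].
pose X w := picard k Q' (Z w); pose X' w := picard k Q (Z' w).
have XX' : (lp_cost p Pr X X' < eta%:E)%E by exact: Hdl.
have XP := has_law_push p1 (picard k Q') ZQ'.
have X'P := has_law_push p1 (picard k Q) Z'Q.
have i0 : (0 <= lp_cost p Pr X X')%E by exact: integral_ge0.
have ifin : lp_cost p Pr X X' \is a fin_num.
  by rewrite ge0_fin_numE// (lt_trans XX')// ltry.
pose i := fine (lp_cost p Pr X X'); pose r := i `^ p^-1.
have iE : lp_cost p Pr X X' = i%:E by rewrite fineK.
have ige0 : 0 <= i by rewrite fine_ge0.
have rp : r `^ p = i by rewrite powRVK.
have Wr t : (wasserstein (stop_law p1 t (picard_law k Q'))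
                         (stop_law p1 t (picard_law k Q)) <= r%:E)%E.
  apply: (wasserstein_stop_le p1 t XP X'P (powR_ge0 _ _)).
  by rewrite rp -iE.
have [mZ _] := ZQ'; have [mZ' _] := Z'Q; have [mX _] := XP; have [mX' _] := X'P.
have := @integral_step_le _ _ Pr Z Z' X X' _ _ A1 A2 A3 i rho mZ mZ' mX mX'
  (measurable_lgmap (picard k.+1 Q') mZ) (measurable_lgmap (picard k.+1 Q) mZ')
  A10 A20 A30 ige0.
move=> /(_ _)/le_lt_trans; apply.
  move=> w; have CD := Cdist _ _ (Z w) (Z' w) (X w) (X' w) r (powR_ge0 _ _) Wr.
  apply: (le_trans (powR_le p1 _ CD)) => //.
  rewrite -rp; apply: powR_step_bound => //; exact: powR_ge0.
rewrite -(ge0_integral_has_law Z'Q (measurable_tail_powR p rho)); last first.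
  by move=> x; rewrite lee_fin tail_powR_ge0.
rewrite iE -EFinD.
have b1 : (A1%:E * lp_cost p Pr Z Z' <= (e / 4)%:E)%E.
  apply: (@le_trans _ _ (A1%:E * (e / 4 / (A1 + 1))%:E)%E).
    by apply: lee_wpmul2l; [rewrite lee_fin|exact: ltW].
  by rewrite -EFinM lee_fin mul_div_le// ltW.
have b2 : (A2%:E * (i + i)%:E <= (e / 4)%:E)%E.
  rewrite -EFinM lee_fin.
  apply: (@le_trans _ _ (A2 * (e / 4 / (A2 + 1)))); last by rewrite mul_div_le// ltW.
  have : i < eta by rewrite -lte_fin -iE.
  by move=> ieta; rewrite ler_wpM2l// [leRHS]splitr lerD// ltW.
have b3 : (A3%:E * \int[Q]_x (tail_powR p rho (x : E))%:E <= (e / 4)%:E)%E.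
  apply: (@le_trans _ _ (A3%:E * (e / 4 / (A3 + 1))%:E)%E).
    by apply: lee_wpmul2l; [rewrite lee_fin|exact: ltW].
  by rewrite -EFinM lee_fin mul_div_le// ltW.
apply: (le_lt_trans (leeD (leeD b1 b2) b3)).
by rewrite -!EFinD lte_fin; exact: three_quarters_lt.
Qed.

(** Both orders of the arguments are needed: open sets are tested by balls with the
    centre as first argument, and convergence to a law has it as second. *)
Lemma picard_law_near k (Q : wspace p E) (e : R) : 0 < e ->
  exists2 dl : R, 0 < dl & forall Q',
    ((wasserstein Q Q' < dl%:E)%E ->
      (wasserstein (picard_law k Q) (picard_law k Q') < e%:E)%E) /\
    ((wasserstein Q' Q < dl%:E)%E ->
      (wasserstein (picard_law k Q') (picard_law k Q) < e%:E)%E).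
Proof.
move=> e0; have e2 : 0 < e / 2 by rewrite divr_gt0.
have e2e : ((e / 2)%:E < e%:E)%E by rewrite lte_fin; lra.
have [dl dl0 Hdl] := picard_stable k Q (powR_gt0 p e2).
exists (dl `^ p^-1); first by rewrite powR_gt0.
move=> Q'; split => /wasserstein_lt[//|g [gQ gQ' ]]; rewrite powRVK ?(ltW dl0)// => cost.
- apply: le_lt_trans e2e; apply: (wasserstein_le p1 sepF
    (has_law_push p1 _ gQ) (has_law_push p1 _ gQ') (ltW e2)).
  rewrite lp_costC; apply: ltW; refine (Hdl _ _ g _ _ Q' gQ' gQ _).
  by rewrite lp_costC; exact: cost.
- apply: le_lt_trans e2e; apply: (wasserstein_le p1 sepF
    (has_law_push p1 _ gQ) (has_law_push p1 _ gQ') (ltW e2)).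
  exact: (ltW (Hdl _ _ g _ _ Q' gQ gQ' cost)).
Qed.

Lemma picard_law_continuous k : continuous (picard_law k).
Proof.
apply/continuousP => A; rewrite !wasserstein_openE => oA Q /= /oA[e e0 eA].
have [dl dl0 Hdl] := picard_law_near k Q e0.
by exists dl => // Q' /(Hdl Q').1 /eA.
Qed.

End stability.

(** * Empirical laws *)

(** The labels [0, ..., n] carry the uniform measure; they are taken in [nat], whose
    subsets are all measurable, and read back in ['I_n.+1] by [inord]. *)
Section uniform_index.
Context (R : realType) (n : nat).
Local Open Scope ereal_scope.

Definition uniform_index (A : set nat) : \bar R :=
  mscale (n.+1%:R^-1%:nng)%R (msum (fun i : nat => \d_i) n.+1) A.

Let uniform_index0 : uniform_index set0 = 0.
Proof. exact: measure0. Qed.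

Let uniform_index_ge0 A : 0 <= uniform_index A.
Proof. by rewrite /uniform_index. Qed.

Let uniform_index_sigma_additive : semi_sigma_additive uniform_index.
Proof. exact: measure_semi_sigma_additive. Qed.

HB.instance Definition _ := isMeasure.Build _ _ _ uniform_index
  uniform_index0 uniform_index_ge0 uniform_index_sigma_additive.

Lemma uniform_indexE (A : set nat) :
  uniform_index A = (n.+1%:R^-1)%R%:E * \sum_(i < n.+1) \d_(i : nat) A.
Proof. by []. Qed.

Let uniform_indexT : uniform_index setT = 1.
Proof.
rewrite uniform_indexE (eq_bigr (fun=> 1%:E)); last first.
  by move=> i _; rewrite diracT.
by rewrite sumEFin sumr_const card_ord -EFinM mulVf.
Qed.

HB.instance Definition _ :=
  Measure_isProbability.Build _ _ _ uniform_index uniform_indexT.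

End uniform_index.

Section empirical_laws.
Context (R : realType) (p : R) (p1 : 1 <= p) (E : normedModType R).
Context (n : nat).

Lemma has_law_empirical (x : 'I_n.+1 -> E) :
  has_law (uniform_index R n) (fun i : nat => x (inord i) : borel E) (empirical p x).
Proof.
split; first by [].
move=> A mA; rewrite wspace_ofE//.
have eqE : \sum_(i < n.+1) \d_(x i : borel E) A =
    \sum_(i < n.+1) \d_(i : nat) ((fun i : nat => x (inord i)) @^-1` A) :> \bar R.
  apply: eq_bigr => i _; rewrite !diracE; congr ((nat_of_bool _)%:R%:E)%E.
  by apply/idP/idP => /set_mem iA; apply/mem_set; move: iA;
    rewrite /preimage /= inord_val.
exact: (congr1 (fun s => ((n.+1%:R^-1)%R%:E * s)%E) eqE).
Qed.

Lemma lp_cost_empirical_le (x y : 'I_n.+1 -> E) (r : R) : separable E ->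
  (forall i, `|x i - y i| <= r) ->
  (lp_cost p (uniform_index R n) (fun i : nat => x (inord i) : borel E)
     (fun i : nat => y (inord i) : borel E) <= (r `^ p)%:E)%E.
Proof.
move=> sepE xy; have -> : ((r `^ p)%:E = \int[uniform_index R n]_i (r `^ p)%:E)%E.
  by rewrite integral_cst//= (@probability_setT _ _ _ (uniform_index R n)) mule1.
apply: ge0_le_integral.
- exact: measurableT.
- by move=> i _; rewrite lee_fin powR_ge0.
- by apply: measurable_dist_powR.
- by [].
by move=> i _; rewrite lee_fin; apply: powR_le.
Qed.

(** Moving every point by less than [r] moves the empirical measure by at most [r]:
    couple the points that have the same label. *)
Lemma empirical_open (sepE : separable E) (U : set (wspace p E)) (x : 'I_n.+1 -> E) :
  open U -> U (empirical p x) -> exists2 r : R, 0 < r &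
    forall y, (forall i, `|x i - y i| < r) -> U (empirical p y).
Proof.
rewrite wasserstein_openE => oU /oU[e e0 eU].
exists (e / 2); first by rewrite divr_gt0.
move=> y xy; apply: eU; apply: (@le_lt_trans _ _ (e / 2)%:E); last first.
  by rewrite lte_fin; lra.
apply: (wasserstein_le p1 sepE (has_law_empirical x) (has_law_empirical y)).
  by rewrite ltW// divr_gt0.
by apply: lp_cost_empirical_le => // i; exact: ltW.
Qed.

Lemma measurable_empirical (sepE : separable E) disp
    (Omega : measurableType disp) (Z : 'I_n.+1 -> Omega -> borel E)
    (A : set (wspace p E)) :
  (forall i, measurable_fun setT (Z i)) -> open A \/ closed A ->
  measurable [set w | A (empirical p (fun i => Z i w : E))].
Proof.
move=> mZ.
have mo (U : set (wspace p E)) : open U ->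
    measurable [set w | U (empirical p (fun i => Z i w : E))].
  move=> oU; apply: (measurable_open_tuple sepE (f := Z)
    (U := [set x | U (empirical p x)])) => // x; exact: empirical_open.
move=> [/mo//|clA].
rewrite -[X in measurable X]setCK; apply: measurableC.
by apply: (mo (~` A)); exact: closed_openC.
Qed.

End empirical_laws.

Section particles.
Context (R : realType) (T : {posnum R}) (p : R) (p1 : 1 <= p) (d d' : nat).
Variable b : R -> cpath T d -> wspace p (cpath T d) -> 'cV[R]_d.
Variable sigma : R -> cpath T d -> wspace p (cpath T d) -> 'M[R]_(d, d').
Hypothesis b_lip : coefficient_lipschitz p1 b.
Hypothesis sigma_lip : coefficient_lipschitz p1 sigma.
Hypothesis sigma_bounded : coefficient_bounded sigma.
Context (h : R) (h0 : 0 < h).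

(** Over the uniform measure on the labels, the law of the particles is their
    empirical measure, so the particle system is a McKean-Vlasov equation. *)
Lemma particle_empirical n (z : 'I_n.+1 -> 'cV[R]_d * cpath T d')
    (x : 'I_n.+1 -> cpath T d) :
  (forall i t, t \in `[0, T%:num] ->
     x i t = euler_map b sigma h (empirical p x) (z i).1 (z i).2 (x i) t) ->
  empirical p x =
  picard_law b_lip sigma_lip sigma_bounded h0 (nb_steps T h) (empirical p z).
Proof.
move=> xE; apply: (solution_law (Pr := uniform_index R n)
  b_lip sigma_lip sigma_bounded h0 (has_law_empirical p z) (has_law_empirical p x)).
by apply: aeW => i; apply/(euler_path_solves _ _ h0) => t tT; exact: xE.
Qed.

End particles.

Lemma ge0_cvge0P (R : realType) (u : nat -> \bar R) : (forall n, 0 <= u n)%E ->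
  u n @[n --> \oo] --> 0%E <->
  forall e : R, 0 < e -> \forall n \near \oo, (u n < e%:E)%E.
Proof.
move=> u0; split.
  move=> /fine_cvgP[fin /cvgrPdist_lt lim] e /lim {}lim; near=> n.
  have fn : u n \is a fin_num by near: n.
  rewrite -(fineK fn) lte_fin; near: n; apply: filterS lim => n /=.
  by rewrite sub0r normrN; apply: le_lt_trans; exact: ler_norm.
move=> lim; apply/fine_cvgP; split.
  by apply: filterS (lim 1 ltr01) => n un; rewrite ge0_fin_numE// (lt_trans un)// ltry.
apply/cvgrPdist_lt => e /[dup] e0 /lim; apply: filterS => n un.
rewrite sub0r normrN ger0_norm ?fine_ge0// -lte_fin fineK//.
by rewrite ge0_fin_numE// (lt_trans un)// ltry.
Unshelve. all: by end_near. Qed.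

(** * Consistency and large deviations of the particle system *)

(* The index n stands for N = n.+1. *)
Theorem corollary2p5 (R : realType) (T : {posnum R}) (d d' : nat)
  (hd : (0 < d)%N) (hd' : (0 < d')%N) (p : R) (p1 : 1 <= p)
  (b : R -> cpath T d -> wspace p (cpath T d) -> 'cV[R]_d)
  (sigma : R -> cpath T d -> wspace p (cpath T d) -> 'M[R]_(d, d'))
  (b_cont : coefficient_continuous b)
  (sigma_cont : coefficient_continuous sigma)
  (b_lip : coefficient_lipschitz p1 b)
  (sigma_lip : coefficient_lipschitz p1 sigma)
  (sigma_bounded : coefficient_bounded sigma)
  (h : R) (h0 : 0 < h)
  (disp : measure_display) (Omega : measurableType disp)
  (Pr : probability Omega R)
  (Z : forall n : nat, 'I_n.+1 -> Lp_rv Pr p ('cV[R]_d * cpath T d')%type)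
  (X : forall n : nat, 'I_n.+1 -> {mfun Omega >-> borel (cpath T d)})
  (X_sol : forall n : nat, particle_solution b sigma h (Z n) (X n)) :
  (forall (Z0 : Lp_rv Pr p ('cV[R]_d * cpath T d')%type)
      (X0 : Lp_rv Pr p (cpath T d)),
    mkv_solution b sigma h Z0 X0 ->
    {ae Pr, forall omega,
      wasserstein (empirical p (fun i => Z n i omega)) (law Z0)
        @[n --> \oo] --> 0%E} ->
    {ae Pr, forall omega,
      wasserstein (empirical p (fun i => X n i omega)) (law X0)
        @[n --> \oo] --> 0%E})
  /\
  (forall I : wspace p ('cV[R]_d * cpath T d')%type -> \bar R,
    LDP (fun n => pushforward Pr
           (fun omega => empirical p (fun i => Z n i omega)
              : borel (wspace p ('cV[R]_d * cpath T d')%type))) I ->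
    LDP (fun n => pushforward Pr
           (fun omega => empirical p (fun i => X n i omega)
              : borel (wspace p (cpath T d))))
        (fun P => ereal_inf [set I Q | Q in [set Q | Psi b sigma h Q = P]])).
Proof.
have sepE : separable ('cV[R]_d * cpath T d')%type.
  by apply: separable_prod; [exact: separable_cV|exact: separable_cpath].
have sepF : separable (cpath T d) by exact: separable_cpath.
pose law_map := picard_law b_lip sigma_lip sigma_bounded h0 (nb_steps T h).
have XE : {ae Pr, forall omega n, empirical p (fun i => X n i omega) =
    law_map (empirical p (fun i => Z n i omega))}.
  apply: ae_foralln => n; apply: filterS (X_sol n) => omega.
  exact: particle_empirical.
split=> [Z0 X0 X0_sol|I ldp].
  apply: filterS2 XE => omega XE.
  have W0 (E : normedModType R) (P Q : wspace p E) : (0 <= wasserstein P Q)%E.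
    exact: poweR_ge0.
  rewrite (mkv_solution_law b_lip sigma_lip sigma_bounded h0 X0_sol).
  move=> /ge0_cvge0P-/(_ (fun=> W0 _ _ _)) lim.
  apply/ge0_cvge0P => [n|e e0]; first exact: W0.
  have [dl dl0 near_law] := picard_law_near b_lip sigma_lip sigma_bounded h0
    (nb_steps T h) (law Z0) e0.
  apply: filterS (lim dl dl0) => n; rewrite XE.
  exact: (near_law _).2.
have -> : (fun P => ereal_inf [set I Q | Q in [set Q | Psi b sigma h Q = P]]) =
    image_rate law_map I.
  apply/funext => P; rewrite /image_rate; congr (ereal_inf (_ @` _)).
  by apply/seteqP; split => Q /=; rewrite (PsiE b_lip sigma_lip sigma_bounded h0).
apply: contraction_principle ldp.
- exact: wspace_hausdorff.
- exact: wspace_hausdorff.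
- exact: picard_law_continuous.
move=> n A ocA; rewrite /pushforward.
apply: ae_eq_measure.
- by apply: measurable_empirical => // i; exact: measurable_funP.
- apply: (measurable_empirical p1 sepE (Z := fun i => Z n i)) => [i|].
    exact: measurable_funP.
  have cf := @picard_law_continuous _ _ _ p1 _ _ _ _ b_lip sigma_lip
    sigma_bounded _ h0 (nb_steps T h).
  case: ocA => [oA|clA]; [left|right].
    by apply: open_comp oA => x _; exact: cf.
  by apply: closed_comp clA => x _; exact: cf.
- by apply: filterS XE => omega XE /=; rewrite /preimage /= XE.
Qed.
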